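(* Let $\alpha,\beta\in\mathbb R\setminus\{0\}$ be of the same sign. Then for every $x\in(0,1)$ the spectrum of $H_{m,x}$ is an interval and $$\sigma(H_{m,x})=\mathrm{supp}(\mu_{m,x})=[-2|\alpha+\beta|,\,2|\alpha+\beta|].$$
   Context: Thompson's group $F$ is the group of homeomorphisms of $[0,1]$ generated by $a,b$, where $a(x)=x/2$ for $x\in[0,\frac12)$, $a(x)=x-\frac14$ for $x\in[\frac12,\frac34)$, $a(x)=2x-1$ for $x\in[\frac34,1]$; and $b(x)=x$ for $x\in[0,\frac12)$, $b(x)=\frac12a(2x-1)+\frac12$ for $x\in[\frac12,1]$. For $x\in(0,1)$ and $m=\alpha(a+a^{-1})+\beta(b+b^{-1})\in\mathbb R[F]$, the operator $H_{m,x}$ on $\ell^2(Fx)$ ($Fx$ the orbit of $x$) is $$(H_{m,x}f)(y)=\alpha\bigl(f(a^{-1}y)+f(ay)\bigr)+\beta\bigl(f(b^{-1}y)+f(by)\bigr),\quad y\in Fx .$$ It is bounded and self-adjoint. If $E$ is its projection-valued spectral measure, $\mu_{m,x}(B)=(E(B)\delta_x,\delta_x)$ for Borel $B\subset\mathbb R$. $\sigma(\cdot)$ denotes the spectrum. *)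

(* Defs.v *)
From HB Require Import structures.
From mathcomp Require Import all_boot all_order all_algebra.
From mathcomp Require Import complex lra ring.
From mathcomp Require Import all_classical all_reals all_analysis.

Set Implicit Arguments.
Unset Strict Implicit.
Unset Printing Implicit Defensive.

Import Order.TTheory GRing.Theory Num.Theory.
Import numFieldNormedType.Exports.

Local Open Scope classical_set_scope.
Local Open Scope ring_scope.
Local Open Scope complex_scope.

Section ThompsonGroup.
Variable R : realType.

Definition I01 : Type := {x : R | 0 <= x <= 1}.

Definition a_fun (x : R) : R :=
  if x < 1 / 2 then x / 2 else if x < 3 / 4 then x - 1 / 4 else 2 * x - 1.
Definition b_fun (x : R) : R :=
  if x < 1 / 2 then x else 1 / 2 * a_fun (2 * x - 1) + 1 / 2.
Definition ai_fun (y : R) : R :=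
  if y < 1 / 4 then 2 * y else if y < 1 / 2 then y + 1 / 4 else (y + 1) / 2.
Definition bi_fun (y : R) : R :=
  if y < 1 / 2 then y else 1 / 2 * ai_fun (2 * y - 1) + 1 / 2.

Lemma a_fun01 x : 0 <= x <= 1 -> 0 <= a_fun x <= 1.
Proof.
by rewrite /a_fun; case: ltP => h1; [|case: ltP => h2] => /andP[? ?]; lra.
Qed.

Lemma ai_fun01 x : 0 <= x <= 1 -> 0 <= ai_fun x <= 1.
Proof.
by rewrite /ai_fun; case: ltP => h1; [|case: ltP => h2] => /andP[? ?]; lra.
Qed.

Lemma b_fun01 x : 0 <= x <= 1 -> 0 <= b_fun x <= 1.
Proof.
rewrite /b_fun; case: ltP => // h1 /andP[x0 x1].
have /a_fun01/andP[? ?] : 0 <= 2 * x - 1 <= 1 by lra.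
by lra.
Qed.

Lemma bi_fun01 x : 0 <= x <= 1 -> 0 <= bi_fun x <= 1.
Proof.
rewrite /bi_fun; case: ltP => // h1 /andP[x0 x1].
have /ai_fun01/andP[? ?] : 0 <= 2 * x - 1 <= 1 by lra.
by lra.
Qed.

Lemma a_funK : cancel a_fun ai_fun.
Proof.
move=> x; rewrite /a_fun.
case: (ltP x (1 / 2)) => ?; [|case: (ltP x (3 / 4)) => ?];
  by rewrite /ai_fun; do 2 ?[case: ltP => ?]; lra.
Qed.

Lemma ai_funK : cancel ai_fun a_fun.
Proof.
move=> x; rewrite /ai_fun.
case: (ltP x (1 / 4)) => ?; [|case: (ltP x (1 / 2)) => ?];
  by rewrite /a_fun; do 2 ?[case: ltP => ?]; lra.
Qed.

Lemma b_funK x : 0 <= x <= 1 -> bi_fun (b_fun x) = x.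
Proof.
rewrite /b_fun; case: ltP => h1 /andP[x0 x1]; rewrite /bi_fun.
  by rewrite h1.
have /a_fun01/andP[? ?] : 0 <= 2 * x - 1 <= 1 by lra.
case: ltP => ?; first by lra.
rewrite [X in ai_fun X](_ : _ = a_fun (2 * x - 1)); last by lra.
by rewrite a_funK; lra.
Qed.

Lemma bi_funK x : 0 <= x <= 1 -> b_fun (bi_fun x) = x.
Proof.
rewrite /bi_fun; case: ltP => h1 /andP[x0 x1]; rewrite /b_fun.
  by rewrite h1.
have /ai_fun01/andP[? ?] : 0 <= 2 * x - 1 <= 1 by lra.
case: ltP => ?; first by lra.
rewrite [X in a_fun X](_ : _ = ai_fun (2 * x - 1)); last by lra.
by rewrite ai_funK; lra.
Qed.

Definition map_a (x : I01) : I01 := exist _ (a_fun (val x)) (a_fun01 (valP x)).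
Definition map_b (x : I01) : I01 := exist _ (b_fun (val x)) (b_fun01 (valP x)).
Definition map_ai (x : I01) : I01 :=
  exist _ (ai_fun (val x)) (ai_fun01 (valP x)).
Definition map_bi (x : I01) : I01 :=
  exist _ (bi_fun (val x)) (bi_fun01 (valP x)).

Lemma map_aK : cancel map_a map_ai.
Proof. by move=> x; apply: val_inj; apply: a_funK. Qed.
Lemma map_aiK : cancel map_ai map_a.
Proof. by move=> x; apply: val_inj; apply: ai_funK. Qed.
Lemma map_bK : cancel map_b map_bi.
Proof. by move=> x; apply: val_inj; apply: b_funK (valP x). Qed.
Lemma map_biK : cancel map_bi map_b.
Proof. by move=> x; apply: val_inj; apply: bi_funK (valP x). Qed.

Inductive thompsonF : (I01 -> I01) -> Prop :=
| F_id : thompsonF id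
| F_a : thompsonF map_a
| F_b : thompsonF map_b
| F_comp g h : thompsonF g -> thompsonF h -> thompsonF (g \o h)
| F_inv g h : thompsonF g -> cancel g h -> cancel h g -> thompsonF h.

Lemma F_ai : thompsonF map_ai.
Proof. exact: F_inv F_a map_aK map_aiK. Qed.
Lemma F_bi : thompsonF map_bi.
Proof. exact: F_inv F_b map_bK map_biK. Qed.

Definition orbit (x : I01) : set I01 :=
  [set y | exists2 g, thompsonF g & y = g x].

Lemma orbit_refl x : x \in orbit x.
Proof. by apply: mem_set; exists id => //; exact: F_id. Qed.

Lemma orbit_closed x g : thompsonF g ->
  forall y, y \in orbit x -> g y \in orbit x.
Proof.
move=> Fg y /set_mem[h Fh ->]; apply: mem_set.
by exists (g \o h) => //; exact: F_comp.
Qed.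

Definition base_point x : orbit x := exist _ x (orbit_refl x).

Definition orbit_act x g (Fg : thompsonF g) (y : orbit x) : orbit x :=
  exist _ (g (val y)) (orbit_closed Fg (valP y)).

Lemma orbit_actK x g h (Fg : thompsonF g) (Fh : thompsonF h) :
  cancel g h -> cancel (@orbit_act x g Fg) (@orbit_act x h Fh).
Proof. by move=> gh y; apply: val_inj; apply: gh. Qed.

End ThompsonGroup.

Section Ell2.
Variables (R : realType) (I : choiceType).

Definition sqmod (z : R[i]) : R := complex.Re z ^+ 2 + complex.Im z ^+ 2.

Lemma sqmod_ge0 z : 0 <= sqmod z.
Proof. by rewrite addr_ge0 ?sqr_ge0. Qed.

Lemma sqmodD z w : sqmod (z + w) <= 2 * sqmod z + 2 * sqmod w.
Proof.
case: z w => [a b] [c d]; rewrite /sqmod /= -subr_ge0.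
rewrite [leRHS](_ : _ = (a - c) ^+ 2 + (b - d) ^+ 2); last by ring.
by rewrite addr_ge0 ?sqr_ge0.
Qed.

Lemma sqmodM z w : sqmod (z * w) = sqmod z * sqmod w.
Proof. by case: z w => [a b] [c d]; rewrite /sqmod /=; ring. Qed.

Definition sq_summable : {pred I -> R[i]} :=
  fun f => (\esum_(i in [set: I]) (sqmod (f i))%:E < +oo)%E.

Lemma esumZ_lty (r : R) (u : I -> R) : 0 <= r -> (forall i, 0 <= u i) ->
  (\esum_(i in [set: I]) (u i)%:E < +oo ->
   \esum_(i in [set: I]) (r * u i)%:E < +oo)%E.
Proof.
move=> r0 u0 uoo.
have ufin : (\esum_(i in [set: I]) (u i)%:E \is a fin_num)%E.
  by rewrite ge0_fin_numE// esum_ge0// => i _; rewrite lee_fin.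
apply: (@le_lt_trans _ _ (r * fine (\esum_(i in [set: I]) (u i)%:E))%:E);
  last exact: ltry.
rewrite EFinM fineK//; apply: ub_ereal_sup => _ [F FI <-].
rewrite fsbig_finite/=; last by case: FI.
under eq_bigr do rewrite EFinM.
rewrite -ge0_sume_distrr; last by move=> i _; rewrite lee_fin.
rewrite lee_wpmul2l ?lee_fin//; apply: ereal_sup_ubound.
by exists F => //; rewrite fsbig_finite//; case: FI.
Qed.

Lemma sq_summable_submod : submod_closed sq_summable.
Proof.
split=> [|c f g Sf Sg].
  rewrite unfold_in /= /sq_summable esum1// => i _.
  by rewrite /sqmod /= expr0n addr0.
rewrite unfold_in /sq_summable.
apply: (@le_lt_trans _ _
  (\esum_(i in [set: I]) (2 * sqmod c * sqmod (f i))%:E +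
   \esum_(i in [set: I]) (2 * sqmod (g i))%:E)%E).
  rewrite -esumD; last 2 first.
  - by move=> i _; rewrite lee_fin !mulr_ge0 ?sqmod_ge0.
  - by move=> i _; rewrite lee_fin !mulr_ge0 ?sqmod_ge0.
  apply: le_esum => i _; rewrite -EFinD lee_fin -mulrA -sqmodM.
  exact: sqmodD.
by apply: lte_add_pinfty; apply: esumZ_lty => //;
  rewrite ?mulr_ge0 ?sqmod_ge0// => i; exact: sqmod_ge0.
Qed.

HB.instance Definition _ := GRing.isSubmodClosed.Build _ _ sq_summable
  sq_summable_submod.

Record ell2 := Ell2 { ell2_fun :> I -> R[i]; ell2P : ell2_fun \in sq_summable }.

HB.instance Definition _ := [isSub for ell2_fun].
HB.instance Definition _ := [Choice of ell2 by <:].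
HB.instance Definition _ := [SubChoice_isSubLmodule of ell2 by <:].

(* Absolutely convergent sums, as sum of positive parts minus sum of negative
   parts. *)
Definition rsum (u : I -> R) : R :=
  fine (\esum_(i in [set: I]) (Num.max (u i) 0)%:E)
  - fine (\esum_(i in [set: I]) (Num.max (- u i) 0)%:E).

Definition csum (u : I -> R[i]) : R[i] :=
  rsum (fun i => complex.Re (u i)) +i* rsum (fun i => complex.Im (u i)).

Definition inner (f g : ell2) : R[i] := csum (fun i => f i * (g i)^*).

Definition ell2_norm (f : ell2) : R := Num.sqrt (complex.Re (inner f f)).

Lemma delta_subproof z : (fun i : I => (i == z)%:R : R[i]) \in sq_summable.
Proof.
rewrite unfold_in /sq_summable.
rewrite (_ : esum _ _ = \esum_(i in [set z]) (1 : R)%:E)%E.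
  by rewrite esum_set1 ?lee_fin// ltry.
rewrite [RHS]esum_mkcond; apply: eq_esum => i _.
rewrite /sqmod; case: ifPn => [/set_mem ->|/negP iz].
  by rewrite eqxx /= expr1n expr0n addr0.
have /negPf -> : i != z by apply/eqP => e; apply: iz; apply: mem_set.
by rewrite /= expr0n addr0.
Qed.

Definition delta z : ell2 := Ell2 (delta_subproof z).

Lemma sq_summable_reindex (e : I -> I) (f : I -> R[i]) :
  bijective e -> f \in sq_summable -> f \o e \in sq_summable.
Proof.
move=> be; rewrite !unfold_in /sq_summable.
by rewrite (reindex_esum [set: I] [set: I] e) //; rewrite setTT_bijective.
Qed.

Definition bounded_op (T : {linear ell2 -> ell2}) : Prop :=
  exists M : R, forall f, ell2_norm (T f) <= M * ell2_norm f.

Definition spectrum (T : {linear ell2 -> ell2}) : set R[i] :=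
  [set z | ~ exists S : {linear ell2 -> ell2},
    [/\ bounded_op S,
        forall f, S (T f - z *: f) = f
      & forall f, T (S f) - z *: S f = f]].

Definition orth_proj (P : {linear ell2 -> ell2}) : Prop :=
  (forall f, P (P f) = P f) /\ (forall f g, inner (P f) g = inner f (P g)).

(* Projection-valued measures on the Borel sets of R with bounded support;
   countable additivity is in the strong operator topology. The values of E on
   non-Borel sets are irrelevant. *)
Record is_pvm (E : set R -> {linear ell2 -> ell2}) : Prop := IsPVM {
  pvm_proj : forall B : set R, measurable B -> orth_proj (E B);
  pvm_set0 : forall f, E set0 f = 0;
  pvm_setT : forall f, E setT f = f;
  pvm_bounded : exists M : R, forall f, E [set` `[- M, M]] f = f;
  pvm_setI : forall A B : set R, measurable A -> measurable B ->
    forall f, E (A `&` B) f = E A (E B f);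
  pvm_sigma_additive : forall B : (set R)^nat,
    (forall n, measurable (B n)) -> trivIset setT B ->
    forall f,
      (fun n => ell2_norm (E (\bigcup_k B k) f - \sum_(k < n) E (B k) f))
      @ \oo --> (0 : R) }.

(* The set function B |-> (E(B) f, f), which is real-valued since E(B) is an
   orthogonal projection. *)
Definition diag_measure (E : set R -> {linear ell2 -> ell2}) (f : ell2) :
  set R -> \bar R := fun B => (complex.Re (inner (E B f) f))%:E.

(* T = \int t dE(t), i.e. (T f, f) = \int t d(E(t) f, f) for all f. The measure
   nu is determined by diag_measure E f on Borel sets; it only packages this set
   function as a measure of the library. *)
Definition is_spectral_measure (T : {linear ell2 -> ell2})
    (E : set R -> {linear ell2 -> ell2}) : Prop :=
  is_pvm E /\
  forall f, exists2 nu : {measure set (measurableTypeR R) -> \bar R},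
    (forall B : set R, measurable B -> nu B = diag_measure E f B)
    & inner (T f) f = (\int[nu]_t t)%:C.

End Ell2.

Definition supp (R : realType) (mu : set R -> \bar R) : set R :=
  [set t | forall U : set R, open U -> U t -> (0 < mu U)%E].

Section Operator.
Variables (R : realType) (alpha beta : R) (x : I01 R).
Local Notation L := (ell2 R (orbit x)).

Definition act_a : orbit x -> orbit x := orbit_act (F_a R).
Definition act_ai : orbit x -> orbit x := orbit_act (F_ai R).
Definition act_b : orbit x -> orbit x := orbit_act (F_b R).
Definition act_bi : orbit x -> orbit x := orbit_act (F_bi R).

Definition H_fun (f : orbit x -> R[i]) : orbit x -> R[i] := fun y =>
  alpha%:C * (f (act_ai y) + f (act_a y)) +
  beta%:C * (f (act_bi y) + f (act_b y)).

Lemma H_subproof (f : L) : H_fun f \in @sq_summable R (orbit x).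
Proof.
have aK : cancel act_a act_ai by apply: orbit_actK; exact: map_aK.
have aiK : cancel act_ai act_a by apply: orbit_actK; exact: map_aiK.
have bK : cancel act_b act_bi by apply: orbit_actK; exact: map_bK.
have biK : cancel act_bi act_b by apply: orbit_actK; exact: map_biK.
pose p e (be : bijective e) : L := Ell2 (sq_summable_reindex be (ell2P f)).
pose h : L :=
  alpha%:C *: (p _ (Bijective aiK aK) + p _ (Bijective aK aiK)) +
  beta%:C *: (p _ (Bijective biK bK) + p _ (Bijective bK biK)).
exact: (ell2P h).
Qed.

Definition H_op (f : L) : L := Ell2 (H_subproof f).

Lemma H_linear : linear H_op.
Proof.
move=> c f g; apply: val_inj; apply/funext => y.
have cfg z : (c *: f + g : L) z = c * f z + g z by [].
suff : H_fun (c *: f + g : L) y = c * H_fun f y + H_fun g y by [].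
by rewrite /H_fun !cfg; ring.
Qed.

HB.instance Definition _ := GRing.isLinear.Build R[i] L L _ H_op H_linear.

End Operator.

Arguments H_op {R} alpha beta x f.
Arguments delta {R I} z.

(* Main.v *)
Require Import Defs.
From HB Require Import structures.
From mathcomp Require Import all_boot all_order all_algebra.
From mathcomp Require Import complex lra ring.
From mathcomp Require Import all_classical all_reals all_analysis.
From mathcomp Require Import measurable_realfun.

(* Near the end point 1 the generators a and b coincide, so the orbit of x ends
   in a ray v_0, v_1, ... on which H f (v_k) = (alpha + beta) (f v_(k+1) +
   f v_(k-1)). Along the ray the eigenvalue equation for t in [-M, M] is a
   three-term recurrence without nonzero square summable solutions; solving
   (H - t) f = delta_(v_j) therefore gives f of norm unbounded in j, so t lies
   in the spectrum, and ||H|| <= M gives the other inclusion.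
   For the support, suppose that E vanishes at delta_x on an interval V around
   t. Let X be the kernel of E(V), where H - t is invertible, and let Z be the
   closed subspace of the f in X that vanish on the ray. By the recurrence,
   (H - t)^-1 maps Z into itself; since (H - t)^-1 is self-adjoint and bounded
   below on X, H - t also maps Z into itself. Hence all H^n delta_x vanish on
   the ray. But as alpha and beta have the same sign, H^n delta_x does not
   vanish at a^-n x, which lies on the ray for large n. *)

Set Implicit Arguments.
Unset Strict Implicit.
Unset Printing Implicit Defensive.

Import Order.TTheory GRing.Theory Num.Theory.
Import numFieldNormedType.Exports.

Local Open Scope classical_set_scope.
Local Open Scope ring_scope.
Local Open Scope complex_scope.

(** * Linearity and reindexing of absolutely convergent sums *)

Section AbsolutelySummable.
Variables (R : realType) (I : choiceType).
Implicit Types u v p q : I -> R.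

Definition abs_summable u : Prop :=
  (\esum_(i in [set: I]) (`|u i|)%:E < +oo)%E.

Lemma abs_summable_fin u : (forall i, 0 <= u i) -> abs_summable u ->
  (\esum_(i in [set: I]) (u i)%:E \is a fin_num)%E.
Proof.
move=> u0 su; rewrite ge0_fin_numE; last by apply: esum_ge0 => i _; rewrite lee_fin.
by apply: le_lt_trans su; apply: le_esum => i _; rewrite lee_fin ler_norm.
Qed.

Lemma le_abs_summable u v : (forall i, `|u i| <= `|v i|) ->
  abs_summable v -> abs_summable u.
Proof.
by move=> uv; apply: le_lt_trans; apply: le_esum => i _; rewrite lee_fin.
Qed.

Lemma abs_summableD u v : abs_summable u -> abs_summable v ->
  abs_summable (fun i => u i + v i).
Proof.
move=> su sv; apply: le_lt_trans (lte_add_pinfty su sv).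
rewrite -esumD => [|i _|i _]; rewrite ?lee_fin//.
by apply: le_esum => i _; rewrite -EFinD lee_fin ler_normD.
Qed.

Lemma abs_summableZ c u : abs_summable u -> abs_summable (fun i => c * u i).
Proof.
move=> su; rewrite /abs_summable; under eq_esum do rewrite normrM.
exact: esumZ_lty.
Qed.

(** One inequality is checked on finite partial sums; for positive [c] the other is the same
    inequality applied to [c^-1] and [c * u]. *)
Lemma esumZ (c : R) u : 0 <= c -> (forall i, 0 <= u i) -> abs_summable u ->
  fine (\esum_(i in [set: I]) (c * u i)%:E) =
  c * fine (\esum_(i in [set: I]) (u i)%:E).
Proof.
have le (d : R) w : 0 <= d -> (forall i, 0 <= w i) -> abs_summable w ->
    fine (\esum_(i in [set: I]) (d * w i)%:E) <=
    d * fine (\esum_(i in [set: I]) (w i)%:E).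
  move=> d0 w0 sw; have wf := abs_summable_fin w0 sw.
  rewrite -lee_fin fineK; last first.
    apply: abs_summable_fin; last exact: abs_summableZ.
    by move=> i; rewrite mulr_ge0.
  rewrite EFinM fineK//; apply: ge_ereal_sup => _ [F FI <-].
  rewrite fsbig_finite/=; last by case: FI.
  under eq_bigr do rewrite EFinM.
  rewrite -ge0_sume_distrr; last by move=> i _; rewrite lee_fin.
  rewrite lee_wpmul2l ?lee_fin//; apply: ereal_sup_ubound.
  by exists F => //; rewrite fsbig_finite//; case: FI.
rewrite le_eqVlt => /orP[/eqP<- u0 su|c0 u0 su].
  by rewrite mul0r esum1// => i _; rewrite mul0r.
apply/le_anti/andP; split; first exact: le (ltW c0) u0 su.
rewrite -ler_pdivlMl//.
apply: le_trans (le c^-1 (fun i => c * u i) _ _ _).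
- by under [in leRHS]eq_esum do rewrite mulKf ?gt_eqF//.
- by rewrite invr_ge0 ltW.
- by move=> i; rewrite mulr_ge0// ltW.
- exact: abs_summableZ.
Qed.

(** [rsum] can be computed from any splitting into nonnegative summable parts. Additivity needs this
    freedom, since the positive part of a sum is not the sum of the positive parts. *)
Lemma rsum_sub p q : (forall i, 0 <= p i) -> (forall i, 0 <= q i) ->
  abs_summable p -> abs_summable q ->
  rsum (fun i => p i - q i) = fine (\esum_(i in [set: I]) (p i)%:E)
                            - fine (\esum_(i in [set: I]) (q i)%:E).
Proof.
move=> p0 q0 sp sq; have spq : abs_summable (fun i => p i - q i).
  apply: le_abs_summable (abs_summableD sp sq) => i.
  by rewrite [leRHS]ger0_norm ?addr_ge0// ler_norml; have := p0 i; have := q0 i; lra.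
rewrite /rsum -!fineB; last 4 first.
- exact: abs_summable_fin.
- exact: abs_summable_fin.
- apply: abs_summable_fin; first by move=> i; rewrite le_max lexx orbT.
  apply: le_abs_summable spq => i; rewrite ger0_norm ?le_max ?lexx ?orbT//.
  by rewrite ge_max ler_norm normr_ge0.
- apply: abs_summable_fin; first by move=> i; rewrite le_max lexx orbT.
  apply: le_abs_summable spq => i; rewrite ger0_norm ?le_max ?lexx ?orbT//.
  by rewrite ge_max normr_ge0 -normrN ler_norm.
congr fine.
rewrite -(@esumB R I setT (EFin \o p) (EFin \o q)) => //=; last 2 first.
- by move=> i _; rewrite lee_fin.
- by move=> i _; rewrite lee_fin.
congr (_ - _)%E; apply: eq_esum => i _.
- by rewrite funeposE EFin_max.
- by rewrite funenegE EFin_max.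
Qed.

Definition pos_part u : I -> R := fun i => Num.max (u i) 0.
Definition neg_part u : I -> R := fun i => Num.max (- u i) 0.

Lemma pos_part_ge0 u i : 0 <= pos_part u i.
Proof. by rewrite le_max lexx orbT. Qed.
Lemma neg_part_ge0 u i : 0 <= neg_part u i.
Proof. by rewrite le_max lexx orbT. Qed.
Lemma pos_neg_part u i : u i = pos_part u i - neg_part u i.
Proof. by rewrite /pos_part /neg_part /Num.max; do 2 case: ltP => ?; lra. Qed.

Lemma abs_summable_pos_part u : abs_summable u -> abs_summable (pos_part u).
Proof.
apply: le_abs_summable => i; rewrite ger0_norm ?pos_part_ge0//.
by rewrite ge_max ler_norm normr_ge0.
Qed.
Lemma abs_summable_neg_part u : abs_summable u -> abs_summable (neg_part u).
Proof.
apply: le_abs_summable => i; rewrite ger0_norm ?neg_part_ge0//.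
by rewrite ge_max normr_ge0 -normrN ler_norm.
Qed.
Hint Resolve pos_part_ge0 neg_part_ge0 abs_summable_pos_part
  abs_summable_neg_part abs_summableD abs_summableZ : core.

Lemma rsumE u : rsum u = fine (\esum_(i in [set: I]) (pos_part u i)%:E)
                       - fine (\esum_(i in [set: I]) (neg_part u i)%:E).
Proof. by []. Qed.

Lemma rsumD u v : abs_summable u -> abs_summable v ->
  rsum (fun i => u i + v i) = rsum u + rsum v.
Proof.
move=> su sv.
have -> : (fun i => u i + v i) = fun i =>
    (pos_part u i + pos_part v i) - (neg_part u i + neg_part v i).
  by apply/funext => i; rewrite [u i]pos_neg_part [v i]pos_neg_part; ring.
rewrite rsum_sub; [|by move=> i; rewrite addr_ge0..|by auto|by auto].
rewrite !rsumE.
under eq_esum do rewrite EFinD.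
under [X in _ - fine X]eq_esum do rewrite EFinD.
rewrite !esumD; [|by move=> i _; rewrite lee_fin..].
by rewrite !fineD ?abs_summable_fin; auto; ring.
Qed.

Lemma rsumN u : rsum (fun i => - u i) = - rsum u.
Proof.
rewrite /rsum opprB; congr (_ - fine _).
by apply: eq_esum => i _; rewrite opprK.
Qed.

Lemma rsumZ c u : abs_summable u -> rsum (fun i => c * u i) = c * rsum u.
Proof.
wlog c0 : c / 0 <= c => [H su|su].
  have [/H->//|c0] := leP 0 c.
  rewrite -[RHS]opprK -mulNr -H//; last by rewrite oppr_ge0 ltW.
  by rewrite -rsumN; congr rsum; apply/funext => i; ring.
have -> : (fun i => c * u i) = fun i => c * pos_part u i - c * neg_part u i.
  by apply/funext => i; rewrite [u i]pos_neg_part; ring.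
rewrite rsum_sub; [|by move=> i; rewrite mulr_ge0..|by auto|by auto].
rewrite (esumZ c0 (pos_part_ge0 u) (abs_summable_pos_part su)).
rewrite (esumZ c0 (neg_part_ge0 u) (abs_summable_neg_part su)).
by rewrite rsumE; ring.
Qed.

Lemma rsum_ge0E u : (forall i, 0 <= u i) ->
  rsum u = fine (\esum_(i in [set: I]) (u i)%:E).
Proof.
move=> u0; rewrite /rsum [X in _ - fine X]esum1 => [|i _]; last first.
  by congr EFin; apply/max_idPr; rewrite oppr_le0.
by rewrite subr0; congr fine; apply: eq_esum => i _; congr EFin; apply/max_idPl.
Qed.

Lemma rsum_reindex (e : I -> I) u : bijective e -> rsum (u \o e) = rsum u.
Proof.
move=> be; have re (w : I -> \bar R) : (forall i, 0 <= w i)%E ->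
    (\esum_(i in [set: I]) w (e i) = \esum_(i in [set: I]) w i)%E.
  by move=> w0; rewrite [RHS](reindex_esum [set: I] [set: I] e) ?setTT_bijective.
rewrite /rsum; congr (fine _ - fine _).
- by rewrite -(re (fun i => (pos_part u i)%:E))// => i; rewrite lee_fin.
- by rewrite -(re (fun i => (neg_part u i)%:E))// => i; rewrite lee_fin.
Qed.

End AbsolutelySummable.

(** * The real Hilbert space structure of [ell2] *)

Section Ell2Geometry.
Variables (R : realType) (I : choiceType).
Local Notation L := (ell2 R I).
Implicit Types (f g h : L) (c : R) (z : R[i]).

Lemma ell2_eqP f g : (forall i, f i = g i) -> f = g.
Proof. by move=> fg; apply: val_inj; apply/funext. Qed.

(** The real part of the inner product determines the norm and is symmetric and real bilinear, so
    conjugates appear only when a complex scalar is moved across, in [dotZ_conj]. *)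
Definition dot f g : R := complex.Re (inner f g).

Let pw f g i : R :=
  complex.Re (f i) * complex.Re (g i) + complex.Im (f i) * complex.Im (g i).

Lemma dotE f g : dot f g = rsum (fun i =>
  complex.Re (f i) * complex.Re (g i) + complex.Im (f i) * complex.Im (g i)).
Proof.
rewrite /dot /inner /csum /=; congr rsum; apply/funext => i.
by case: (f i) (g i) => [a b] [c d] /=; ring.
Qed.

Lemma abs_summable_sqmod f : abs_summable (fun i => sqmod (f i)).
Proof.
rewrite /abs_summable; under eq_esum do rewrite ger0_norm ?sqmod_ge0//.
exact: (ell2P f).
Qed.

Let pwS f g : abs_summable (pw f g).
Proof.
apply: le_abs_summable
  (abs_summableD (abs_summable_sqmod f) (abs_summable_sqmod g)) => i.
rewrite [leRHS]ger0_norm; last by rewrite addr_ge0 ?sqmod_ge0.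
rewrite /pw /sqmod.
case: (f i) (g i) => [a b] [c d] /=.
have := sqr_ge0 (a - c); have := sqr_ge0 (b - d).
have := sqr_ge0 (a + c); have := sqr_ge0 (b + d).
by rewrite ler_norml => *; apply/andP; split; nra.
Qed.

Lemma dotC f g : dot f g = dot g f.
Proof. by rewrite !dotE; congr rsum; apply/funext => i; ring. Qed.

Lemma dotDl f g h : dot (f + g) h = dot f h + dot g h.
Proof.
rewrite !dotE -rsumD; [|exact: pwS..].
congr rsum; apply/funext => i.
rewrite [(f + g) i](_ : _ = f i + g i)//.
by case: (f i) (g i) => [a b] [c d] /=; ring.
Qed.

Lemma dotZl c f g : dot (c%:C *: f) g = c * dot f g.
Proof.
rewrite !dotE -rsumZ; last exact: pwS.
congr rsum; apply/funext => i.
rewrite [(_ *: f) i](_ : _ = c%:C * f i)//.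
by case: (f i) => [a b] /=; ring.
Qed.

Lemma dotZ_conj z f g : dot (z *: f) g = dot f (z^* *: g).
Proof.
rewrite !dotE; congr rsum; apply/funext => i.
rewrite [(_ *: f) i](_ : _ = z * f i)// [(_ *: g) i](_ : _ = z^* * g i)//.
by case: z (f i) (g i) => [a b] [c d] [e k] /=; ring.
Qed.

Lemma dotDr f g h : dot h (f + g) = dot h f + dot h g.
Proof. by rewrite !(dotC h) dotDl. Qed.
Lemma dotZr c f g : dot g (c%:C *: f) = c * dot g f.
Proof. by rewrite !(dotC g) dotZl. Qed.
Lemma dotNl f g : dot (- f) g = - dot f g.
Proof. by rewrite -[- f]scaleN1r -(rmorph1 (real_complex R)) -rmorphN dotZl mulN1r. Qed.
Lemma dotNr f g : dot g (- f) = - dot g f.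
Proof. by rewrite !(dotC g) dotNl. Qed.
Lemma dot0l g : dot 0 g = 0.
Proof. by rewrite -(scale0r 0) -(rmorph0 (real_complex R)) dotZl mul0r. Qed.
Lemma dot0r g : dot g 0 = 0.
Proof. by rewrite dotC dot0l. Qed.

Definition dot_lin := (dotDl, dotDr, dotNl, dotNr, dotZl, dotZr, dot0l, dot0r).

Lemma dot_self f : dot f f = fine (\esum_(i in [set: I]) (sqmod (f i))%:E).
Proof.
rewrite dotE -rsum_ge0E => [|i]; last exact: sqmod_ge0.
by congr rsum; apply/funext => i; rewrite -!expr2.
Qed.

Lemma dot_ge0 f : 0 <= dot f f.
Proof. by rewrite dot_self fine_ge0// esum_ge0// => i _; rewrite lee_fin sqmod_ge0. Qed.

Lemma sum_sqmod_le f (s : seq I) : uniq s ->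
  \sum_(i <- s) sqmod (f i) <= dot f f.
Proof.
move=> us; rewrite dot_self -lee_fin fineK; last first.
  apply: abs_summable_fin; last exact: abs_summable_sqmod.
  by move=> i; exact: sqmod_ge0.
apply: ereal_sup_ubound; exists [set` s]; first by split.
by rewrite -fsbig_seq// sumEFin.
Qed.

Lemma sqmod_le_dot f i : sqmod (f i) <= dot f f.
Proof. by have := @sum_sqmod_le f [:: i] isT; rewrite big_seq1. Qed.

Lemma dot_eq0 f : dot f f = 0 -> f = 0.
Proof.
move=> f0; apply: ell2_eqP => i; have := sqmod_le_dot f i.
rewrite f0 => fi0; have /eqP : sqmod (f i) = 0 by apply/le_anti; rewrite fi0 sqmod_ge0.
rewrite /sqmod paddr_eq0 ?sqr_ge0// !sqrf_eq0 => /andP[/eqP a0 /eqP b0].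
by rewrite [RHS](_ : _ = 0)//; case: (f i) a0 b0 => [a b] /= -> ->.
Qed.

Lemma ell2_normE f : ell2_norm f = Num.sqrt (dot f f).
Proof. by []. Qed.

Lemma ell2_norm_ge0 f : 0 <= ell2_norm f.
Proof. exact: sqrtr_ge0. Qed.

Lemma sqr_ell2_norm f : ell2_norm f ^+ 2 = dot f f.
Proof. by rewrite sqr_sqrtr// dot_ge0. Qed.

Lemma ell2_norm_le c f : 0 <= c -> (ell2_norm f <= c) = (dot f f <= c ^+ 2).
Proof. by move=> c0; rewrite -sqr_ell2_norm ler_sqr// nnegrE ell2_norm_ge0. Qed.

Lemma ell2_norm_eq0 f : ell2_norm f = 0 -> f = 0.
Proof. by move=> f0; apply: dot_eq0; rewrite -sqr_ell2_norm f0 expr0n. Qed.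

Lemma ell2_norm0 : ell2_norm (0 : L) = 0.
Proof. by rewrite ell2_normE dot0l sqrtr0. Qed.

(** Cauchy-Schwarz: with [a], [b] the norms and [d] the product, the square of [b f - a g] is
    [2 a b (a b - d)]. Zero norms are treated apart. *)
Lemma dot_le_norm f g : dot f g <= ell2_norm f * ell2_norm g.
Proof.
have [g0|gN0] := eqVneq (ell2_norm g) 0.
  by rewrite g0 mulr0 (ell2_norm_eq0 g0) dot0r.
have gp : 0 < ell2_norm g by rewrite lt_def gN0 ell2_norm_ge0.
have := dot_ge0 ((ell2_norm g)%:C *: f - (ell2_norm f)%:C *: g).
rewrite !dot_lin (dotC g f) -!sqr_ell2_norm.
set a := ell2_norm f; set b := ell2_norm g; set d := dot f g => H.
have [a0|aN0] := eqVneq a 0.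
  by rewrite /d (ell2_norm_eq0 a0) dot0l a0 mul0r.
have ap : 0 < a by rewrite lt_def aN0 ell2_norm_ge0.
rewrite -subr_ge0 -(pmulr_rge0 _ (mulr_gt0 ap gp)).
by rewrite -/b; lra.
Qed.

Lemma ell2_normD f g : ell2_norm (f + g) <= ell2_norm f + ell2_norm g.
Proof.
rewrite ell2_norm_le ?addr_ge0 ?ell2_norm_ge0// !dot_lin (dotC g f).
by have := dot_le_norm f g; rewrite -!sqr_ell2_norm; lra.
Qed.

Lemma dotZZ z f : dot (z *: f) (z *: f) = sqmod z * dot f f.
Proof.
rewrite dotZ_conj scalerA -dotZr; congr (dot f (_ *: f)).
by case: z => a b; rewrite /sqmod /=; simpc; congr (_ +i* _); ring.
Qed.

Lemma ell2_normZ c f : ell2_norm (c%:C *: f) = `|c| * ell2_norm f.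
Proof.
rewrite ell2_normE dotZZ sqrtrM ?sqmod_ge0// /sqmod /= expr0n addr0.
by rewrite sqrtr_sqr.
Qed.

Lemma ell2_normN f : ell2_norm (- f) = ell2_norm f.
Proof. by rewrite !ell2_normE !dot_lin opprK. Qed.

Lemma ell2_norm_subC f g : ell2_norm (f - g) = ell2_norm (g - f).
Proof. by rewrite -ell2_normN opprB. Qed.

Definition reindex_ell2 (e : I -> I) (be : bijective e) f : L :=
  Ell2 (sq_summable_reindex be (ell2P f)).

Lemma dot_reindex e (be : bijective e) f g :
  dot (reindex_ell2 be f) (reindex_ell2 be g) = dot f g.
Proof.
rewrite !dotE; exact: (@rsum_reindex R I e (fun i =>
  complex.Re (f i) * complex.Re (g i) + complex.Im (f i) * complex.Im (g i))).
Qed.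

Lemma Re_le_norm f i : `|complex.Re (f i)| <= ell2_norm f.
Proof.
rewrite -sqrtr_sqr ler_wsqrtr//; apply: le_trans (sqmod_le_dot f i).
by rewrite lerDl sqr_ge0.
Qed.

Lemma Im_le_norm f i : `|complex.Im (f i)| <= ell2_norm f.
Proof.
rewrite -sqrtr_sqr ler_wsqrtr//; apply: le_trans (sqmod_le_dot f i).
by rewrite lerDr sqr_ge0.
Qed.

Definition ell2_lim (F : nat -> L) f : Prop :=
  forall e : R, 0 < e -> exists N, forall n, (N <= n)%N -> ell2_norm (f - F n) <= e.

Lemma ell2_lim_unique F f g : ell2_lim F f -> ell2_lim F g -> f = g.
Proof.
move=> Ff Fg; apply/eqP; rewrite -subr_eq0; apply/eqP/ell2_norm_eq0/eqP.
rewrite eq_le ell2_norm_ge0 andbT; apply/ler_addgt0Pl => e e0; rewrite addr0.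
have e2 : 0 < e / 2 by rewrite divr_gt0.
have [N1 H1] := Ff _ e2; have [N2 H2] := Fg _ e2.
have := H1 _ (leq_maxl N1 N2); have := H2 _ (leq_maxr N1 N2).
rewrite (ell2_norm_subC g) => h1 h2.
rewrite -(subrKA (F (maxn N1 N2))); apply: le_trans (ell2_normD _ _) _.
by lra.
Qed.

Let cvg_sqr_sub (u : nat -> R) (a b : R) : u @ \oo --> a ->
  (fun n => (u n - b) ^+ 2) @ \oo --> (a - b) ^+ 2.
Proof.
move=> ua; have h : (fun n => u n - b) @ \oo --> a - b by exact: cvgB ua (cvg_cst b).
exact: (cvgM h h).
Qed.

Let cauchy_real (u : nat -> R) :
  (forall e : R, 0 < e -> exists N, forall m n,
     (N <= m)%N -> (N <= n)%N -> `|u m - u n| <= e) ->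
  cvg (u @ \oo).
Proof.
move=> H; apply: cauchy_cvg; apply: cauchy_exP => e e0.
have [N HN] := H _ (divr_gt0 e0 (ltr0Sn R 1)).
exists (u N); exists N => // n /= Nn; rewrite /ball /=.
by apply: le_lt_trans (HN _ _ (leqnn N) Nn) _; lra.
Qed.

(** The coordinates converge because the reals are complete; the Cauchy bounds then pass to the
    coordinatewise limit [l]. *)
Lemma ell2_complete (F : nat -> L) :
  (forall e : R, 0 < e -> exists N, forall m n,
     (N <= m)%N -> (N <= n)%N -> ell2_norm (F m - F n) <= e) ->
  exists f, ell2_lim F f.
Proof.
move=> cF.
have cRe i : cvg ((fun n => complex.Re (F n i)) @ \oo).
  apply: cauchy_real => e /cF[N HN]; exists N => m n Nm Nn.
  apply: le_trans (HN _ _ Nm Nn); apply: le_trans (Re_le_norm (F m - F n) i).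
  rewrite [(F m - F n : L) i](_ : _ = F m i - F n i)//.
  by case: (F m i) (F n i) => [a b] [c d].
have cIm i : cvg ((fun n => complex.Im (F n i)) @ \oo).
  apply: cauchy_real => e /cF[N HN]; exists N => m n Nm Nn.
  apply: le_trans (HN _ _ Nm Nn); apply: le_trans (Im_le_norm (F m - F n) i).
  rewrite [(F m - F n : L) i](_ : _ = F m i - F n i)//.
  by case: (F m i) (F n i) => [a b] [c d].
pose l i : R[i] := lim ((fun n => complex.Re (F n i)) @ \oo)
               +i* lim ((fun n => complex.Im (F n i)) @ \oo).
(* Fatou's argument: on a finite set of indices the bound survives the limit in [m], and the full
   sum is the supremum over such sets. *)
have fatou e N : 0 < e -> (forall m n, (N <= m)%N -> (N <= n)%N ->
      ell2_norm (F m - F n) <= e) ->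
    forall n, (N <= n)%N -> forall s : seq I, uniq s ->
    \sum_(i <- s) sqmod (l i - F n i) <= e ^+ 2.
  move=> e0 HN n Nn s us.
  apply: (@cvgr_to_le _ \oo _ _ (fun m => \sum_(i <- s) sqmod (F m i - F n i))).
    apply: cvg_big => [|i _]; first exact: add_continuous.
    rewrite /sqmod.
    have sub (w w' : R[i]) : (complex.Re (w - w') = complex.Re w - complex.Re w')
        * (complex.Im (w - w') = complex.Im w - complex.Im w').
      by case: w w' => [a b] [c d].
    rewrite !sub; under eq_cvg do rewrite !sub.
    exact: (cvgD (cvg_sqr_sub (cRe i)) (cvg_sqr_sub (cIm i))).
  exists N => // m /= Nm; apply: le_trans (sum_sqmod_le (F m - F n) us) _.
  by rewrite -ell2_norm_le; [exact: HN|exact: ltW].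
have summ e N : 0 < e -> (forall m n, (N <= m)%N -> (N <= n)%N ->
      ell2_norm (F m - F n) <= e) -> forall n, (N <= n)%N ->
    (\esum_(i in [set: I]) (sqmod (l i - F n i))%:E <= (e ^+ 2)%:E)%E.
  move=> e0 HN n Nn; apply: ge_ereal_sup => _ [A [Afin _] <-].
  rewrite fsbig_finite//= sumEFin lee_fin.
  exact: (fatou _ _ e0 HN).
have [N0 HN0] := cF 1 ltr01.
have hS : (fun i => l i - F N0 i) \in @sq_summable R I.
  rewrite unfold_in /sq_summable.
  exact: le_lt_trans (summ _ _ ltr01 HN0 N0 (leqnn _)) (ltry _).
(* Square summability was obtained for [l - F N0], so [l] enters [ell2] as this difference plus
   [F N0]. *)
exists (Ell2 hS + F N0) => e e0; have [N HN] := cF e e0; exists N => n Nn.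
rewrite ell2_norm_le; last exact: ltW.
rewrite dot_self -lee_fin fineK; last first.
  apply: abs_summable_fin; last exact: abs_summable_sqmod.
  by move=> i; exact: sqmod_ge0.
apply: le_trans (summ _ _ e0 HN n Nn); apply: le_esum => i _; rewrite lee_fin.
rewrite [(Ell2 hS + F N0 - F n : L) i](_ : _ = l i - F N0 i + F N0 i - F n i)//.
by rewrite subrK.
Qed.

Lemma ell2_geometric_cvg (F : nat -> L) (C q : R) : 0 <= q < 1 ->
  (forall n, ell2_norm (F n.+1 - F n) <= C * q ^+ n) ->
  exists f, ell2_lim F f.
Proof.
move=> /andP[q0 q1] H; have q1' : 0 < 1 - q by rewrite subr_gt0.
have C0 : 0 <= C by have := H 0; rewrite expr0 mulr1; apply: le_trans (ell2_norm_ge0 _).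
have tail n k : ell2_norm (F (n + k)%N - F n) <= C * q ^+ n / (1 - q) * (1 - q ^+ k).
  elim: k => [|k IH]; first by rewrite addn0 subrr ell2_norm0 expr0 subrr mulr0.
  rewrite addnS -(subrKA (F (n + k)%N)); apply: le_trans (ell2_normD _ _) _.
  apply: le_trans (lerD (H _) IH) _; rewrite exprD exprS le_eqVlt; apply/orP; left.
  by apply/eqP; field; rewrite gt_eqF.
have tail' n k : ell2_norm (F (n + k)%N - F n) <= C / (1 - q) * q ^+ n.
  apply: le_trans (tail n k) _; rewrite [leRHS](_ : _ = C * q ^+ n / (1 - q) * 1); last by ring.
  rewrite ler_wpM2l//.
    by rewrite !mulr_ge0 ?exprn_ge0 ?invr_ge0//; exact: ltW.
  by rewrite gerBl exprn_ge0.
apply: ell2_complete => e e0.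
have : (fun n => C / (1 - q) * q ^+ n) @ \oo --> C / (1 - q) * 0.
  by apply: cvgM; [exact: cvg_cst|apply: cvg_expr; rewrite ger0_norm].
rewrite mulr0 => /cvgrPdist_le /(_ (e / 2)) [|N _ HN]; first by rewrite divr_gt0.
exists N => m n Nm Nn.
have := HN N (leqnn N) => /=; rewrite sub0r normrN => /(le_trans (ler_norm _)) le2.
rewrite -(subrKA (F N)); apply: le_trans (ell2_normD _ _) _.
have := tail' N (m - N)%N; have := tail' N (n - N)%N.
by rewrite !subnKC// (ell2_norm_subC (F n)); lra.
Qed.

End Ell2Geometry.

(** * Solving equations in closed subspaces by Landweber iteration *)

Section Landweber.
Variables (R : realType) (I : choiceType).
Local Notation L := (ell2 R I).
Implicit Types (X Z : set L) (D : {linear L -> L}).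

(** Real scalars suffice: the iterations below have real coefficients. *)
Definition closed_subspace X : Prop :=
  [/\ X 0, forall f g (c : R), X f -> X g -> X (f + c%:C *: g)
    & forall f, (forall e : R, 0 < e -> exists2 g, X g & ell2_norm (f - g) <= e) ->
      X f].

Lemma eval_closed i : closed_subspace [set f : L | f i = 0].
Proof.
split=> [|f g c /= fi gi|f /= Hf]; first by [].
  by rewrite [LHS](_ : _ = f i + c%:C * g i)// fi gi mulr0 addr0.
have small (e : R) : 0 < e ->
    `|complex.Re (f i)| <= e /\ `|complex.Im (f i)| <= e.
  move=> /Hf[g gi fg].
  have E : (f - g : L) i = f i by rewrite [LHS](_ : _ = f i - g i)// gi subr0.
  by rewrite -E; split; apply: le_trans fg; [exact: Re_le_norm|exact: Im_le_norm].
have re : complex.Re (f i) = 0.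
  apply/eqP; rewrite -normr_le0; apply/ler_addgt0Pl => e /small[].
  by rewrite addr0.
have im : complex.Im (f i) = 0.
  apply/eqP; rewrite -normr_le0; apply/ler_addgt0Pl => e /small[].
  by rewrite addr0.
by case: (f i) re im => a b /= -> ->.
Qed.

(** The contraction factor of the squared residuals. It dominates [1 - eps^2 / K^2], the factor
    given by the estimates, and lies in []0, 1[] even when [eps] exceeds [K]. *)
Definition landweber_rate (eps K : R) : R := K ^+ 2 / (K ^+ 2 + eps ^+ 2).

Lemma landweber_rate_itv (eps K : R) : 0 < eps -> 0 < K ->
  0 < landweber_rate eps K < 1.
Proof.
move=> e0 K0; have := exprn_gt0 2 e0; have := exprn_gt0 2 K0 => K2 e2.
rewrite divr_gt0 ?addr_gt0//= ltr_pdivrMr ?addr_gt0//; lra.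
Qed.

Lemma landweber_rate_ge (eps K : R) : 0 < eps -> 0 < K ->
  1 - eps ^+ 2 / K ^+ 2 <= landweber_rate eps K.
Proof.
move=> e0 K0; have := exprn_gt0 2 e0; have := exprn_gt0 2 K0 => K2 e2.
rewrite /landweber_rate ler_pdivlMr ?addr_gt0// -subr_ge0.
rewrite [X in 0 <= X](_ : _ = eps ^+ 2 * eps ^+ 2 / K ^+ 2); last first.
  by field; rewrite gt_eqF.
by rewrite !mulr_ge0 ?invr_ge0 ?ltW.
Qed.

Lemma expr_small (q b e : R) : 0 <= q < 1 -> 0 < e ->
  exists N, forall n, (N <= n)%N -> b * q ^+ n <= e.
Proof.
move=> /andP[q0 q1] e0.
have : (fun n => b * q ^+ n) @ \oo --> b * 0.
  by apply: cvgM; [exact: cvg_cst|apply: cvg_expr; rewrite ger0_norm].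
rewrite mulr0 => /cvgrPdist_le /(_ e e0) [N _ HN].
exists N => n Nn; apply: le_trans (ler_norm _) _.
by have := HN n Nn => /=; rewrite sub0r normrN.
Qed.

Lemma ell2_norm_le_expr (f : nat -> L) (q b : R) : 0 <= q -> 0 <= b ->
  (forall n, dot (f n) (f n) <= q ^+ n * b ^+ 2) ->
  forall n, ell2_norm (f n) <= b * Num.sqrt q ^+ n.
Proof.
move=> q0 b0 H n; rewrite ell2_norm_le ?mulr_ge0 ?exprn_ge0 ?sqrtr_ge0//.
by rewrite exprMn -exprM mulnC exprM sqr_sqrtr// mulrC.
Qed.

Lemma sqrtr_itv (q : R) : 0 < q < 1 -> 0 <= Num.sqrt q < 1.
Proof.
by move=> /andP[q0 q1]; rewrite sqrtr_ge0/= -sqrtr1 ltr_sqrt.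
Qed.

Lemma dot_le_of_norm (c : R) (f g : L) : 0 <= c ->
  ell2_norm f <= c * ell2_norm g -> dot f f <= c ^+ 2 * dot g g.
Proof.
move=> c0 fg; rewrite -!sqr_ell2_norm -exprMn.
by apply: lerXn2r fg; rewrite nnegrE ?mulr_ge0 ?ell2_norm_ge0.
Qed.

Lemma dot_ge_of_norm (c : R) (f g : L) : 0 <= c ->
  c * ell2_norm f <= ell2_norm g -> c ^+ 2 * dot f f <= dot g g.
Proof.
move=> c0 fg; rewrite -!sqr_ell2_norm -exprMn.
by apply: lerXn2r fg; rewrite nnegrE ?mulr_ge0 ?ell2_norm_ge0.
Qed.

(* Solves [D f = g] by the iteration [f' = f + K^-2 D' (g - D f)], whose
   residuals decrease geometrically. *)
Lemma landweber_surj X D D' (eps K : R) : 0 < eps -> 0 < K ->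
  closed_subspace X ->
  (forall f g, dot (D f) g = dot f (D' g)) ->
  (forall f, X f -> X (D f)) -> (forall f, X f -> X (D' f)) ->
  (forall f, ell2_norm (D f) <= K * ell2_norm f) ->
  (forall f, ell2_norm (D' f) <= K * ell2_norm f) ->
  (forall f, X f -> eps * ell2_norm f <= ell2_norm (D' f)) ->
  forall g, X g -> exists2 f, X f & D f = g.
Proof.
move=> e0 K0 [X0 Xlin Xcl] adj XD XD' DK D'K D'e g Xg.
pose k : R := (K ^+ 2)^-1.
have k0 : 0 < k by rewrite invr_gt0 exprn_gt0.
pose F := fix F n := if n is m.+1 then F m + k%:C *: D' (g - D (F m)) else 0.
pose r n := g - D (F n).
have XF n : X (F n).
  elim: n => [|n IH] //=; apply: (Xlin) => //; apply: (XD').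
  rewrite -[X in _ - X]scale1r -scaleNr -(rmorph1 (real_complex R)) -rmorphN.
  by apply: (Xlin) => //; exact: XD.
have Xr n : X (r n).
  rewrite /r -[X in _ - X]scale1r -scaleNr -(rmorph1 (real_complex R)) -rmorphN.
  by apply: (Xlin) => //; exact: XD.
have rS n : r n.+1 = r n - k%:C *: D (D' (r n)).
  by rewrite /r /= linearD linearZ opprD addrA.
pose q := landweber_rate eps K.
have qI := landweber_rate_itv e0 K0.
have /andP[/ltW q0 q1] := qI.
have rle n : dot (r n) (r n) <= q ^+ n * ell2_norm g ^+ 2.
  elim: n => [|n IH]; first by rewrite /r /= linear0 subr0 expr0 mul1r sqr_ell2_norm.
  rewrite [q ^+ _.+1]exprS -mulrA; apply: le_trans (ler_wpM2l q0 IH).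
  rewrite rS; move: (r n) (Xr n) => s Xs.
  (* The new squared residual is [|s|^2 - 2 k |D' s|^2 + k^2 |D D' s|^2]. The last term is at most
     [k |D' s|^2], and [|D' s|] is at least [eps |s|]. *)
  rewrite !dot_lin (dotC s) adj.
  set w := dot (D' s) (D' s).
  have h1 : dot (D (D' s)) (D (D' s)) <= K ^+ 2 * w by apply: dot_le_of_norm (ltW K0) (DK _).
  have h2 : eps ^+ 2 * dot s s <= w by apply: dot_ge_of_norm (ltW e0) (D'e _ Xs).
  have h3 : k * (k * dot (D (D' s)) (D (D' s))) <= k * w.
    rewrite ler_pM2l// /k ler_pdivrMl ?exprn_gt0//.
  have h4 : k * (eps ^+ 2 * dot s s) <= k * w by rewrite ler_pM2l.
  have h5 := ler_wpM2r (dot_ge0 s) (landweber_rate_ge e0 K0).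
  by rewrite -/k in h5; lra.
have rn := ell2_norm_le_expr q0 (ell2_norm_ge0 g) rle.
have qq := sqrtr_itv qI.
have [f Ff] : exists f, ell2_lim F f.
  apply: (@ell2_geometric_cvg _ _ F (k * K * ell2_norm g) (Num.sqrt q)) => // n.
  rewrite /= addrC addKr ell2_normZ gtr0_norm// -!mulrA ler_pM2l//.
  apply: le_trans (D'K _) _; rewrite ler_pM2l//; exact: rn.
exists f.
  by apply: Xcl => e /Ff[N HN]; exists (F N) => //; exact: HN.
(* [D \o F] tends to [D f] by continuity, and to [g] because the residuals tend to 0. *)
apply: (@ell2_lim_unique _ _ (D \o F)) => e e1.
  have [N HN] := Ff _ (divr_gt0 e1 K0); exists N => n Nn.
  rewrite /= -linearB; apply: le_trans (DK _) _.
  by rewrite mulrC -ler_pdivlMr//; exact: HN.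
have [N HN] := expr_small (ell2_norm g) qq e1.
by exists N => n Nn; apply: le_trans (rn n) _; exact: HN.
Qed.

(* [D z] is the limit of the iterates [w' = w + eps^2 A (z - A w)], [A] being
   the inverse of [D] on [X]; these iterates remain in [Z]. *)
Lemma landweber_stable X Z D (eps K : R) : 0 < eps -> 0 < K ->
  closed_subspace X -> closed_subspace Z -> Z `<=` X ->
  (forall f g, dot (D f) g = dot f (D g)) ->
  (forall f, X f -> X (D f)) ->
  (forall f, ell2_norm (D f) <= K * ell2_norm f) ->
  (forall f, X f -> eps * ell2_norm f <= ell2_norm (D f)) ->
  (forall f, X f -> Z (D f) -> Z f) ->
  forall z, Z z -> Z (D z).
Proof.
move=> e0 K0 cX [Z0 Zlin Zcl] ZX sym XD DK De DZ z Zz.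
have surj := landweber_surj e0 K0 cX sym XD XD DK DK De.
have [X0 Xlin Xcl] := cX.
have Zsub f g : Z f -> Z g -> Z (f - g).
  rewrite -[X in _ - X]scale1r -scaleNr -(rmorph1 (real_complex R)) -rmorphN.
  exact: Zlin.
have Xsub f g : X f -> X g -> X (f - g).
  rewrite -[X in _ - X]scale1r -scaleNr -(rmorph1 (real_complex R)) -rmorphN.
  exact: Xlin.
pose q := landweber_rate eps K.
have qI := landweber_rate_itv e0 K0.
have /andP[/ltW q0 q1] := qI.
have /choice[w Hw] n : exists w, Z w /\
    dot (D z - w) (D z - w) <= q ^+ n * ell2_norm (D z) ^+ 2.
  elim: n => [|n [w [Zw IH]]].
    by exists 0; split=> //; rewrite subr0 expr0 mul1r sqr_ell2_norm.
  (* Here [u = A w] and [v = A (z - u)]; both stay in [Z] because [DZ] says that [A] maps [Z] into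
     itself. *)
  have [u Xu Du] := surj w (ZX _ Zw).
  have Zu : Z u by apply: DZ => //; rewrite Du.
  have Zzu := Zsub _ _ Zz Zu.
  have [v Xv Dv] := surj _ (ZX _ Zzu).
  have Zv : Z v by apply: DZ => //; rewrite Dv.
  exists (w + (eps ^+ 2)%:C *: v); split; first exact: Zlin.
  rewrite [q ^+ _.+1]exprS -mulrA; apply: le_trans (ler_wpM2l q0 IH).
  (* The old residual is [D (z - u) = D (D v)], named [y] below, and the new one is [y - eps^2 v].
     Since [dot y v = |D v|^2], the lower bound on [D v] and the upper bound on [y] give the factor
     [1 - eps^2 / K^2]. *)
  rewrite opprD addrA -Du -linearB -Dv.
  set y := D (D v).
  have h1 : eps ^+ 2 * dot v v <= dot (D v) (D v) by apply: dot_ge_of_norm (ltW e0) (De _ Xv).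
  have h2 : dot y y <= K ^+ 2 * dot (D v) (D v) by apply: dot_le_of_norm (ltW K0) (DK _).
  have yv : dot y v = dot (D v) (D v) by exact: sym.
  rewrite !dot_lin (dotC v) yv.
  have h3 : eps ^+ 2 * (eps ^+ 2 * dot v v) <= eps ^+ 2 * dot (D v) (D v).
    by rewrite ler_pM2l ?exprn_gt0.
  have h4 : eps ^+ 2 / K ^+ 2 * dot y y <= eps ^+ 2 * dot (D v) (D v).
    by rewrite -mulrA ler_pM2l ?exprn_gt0// ler_pdivrMl ?exprn_gt0.
  have h5 := ler_wpM2r (dot_ge0 y) (landweber_rate_ge e0 K0).
  lra.
apply: Zcl => e e1; have [N HN] := expr_small (ell2_norm (D z)) (sqrtr_itv qI) e1.
exists (w N); first by case: (Hw N).
apply: le_trans (HN _ (leqnn N)).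
have Hw2 n := (Hw n).2.
exact: (ell2_norm_le_expr q0 (ell2_norm_ge0 (D z)) Hw2).
Qed.

End Landweber.

(** * Spectral projections, the subspaces they reduce, and spectral gaps *)

Section SpectralMeasure.
Variables (R : realType) (I : choiceType).
Local Notation L := (ell2 R I).
Variables (T : {linear L -> L}) (E : set R -> {linear L -> L}).
Hypothesis Tsym : forall f g, dot (T f) g = dot f (T g).
Hypothesis HE : is_spectral_measure T E.
Implicit Types (A B C : set R) (f g : L).

Let pvm : is_pvm E := HE.1.

Lemma pvm_dot B f g : measurable B -> dot (E B f) g = dot f (E B g).
Proof. by move=> mB; rewrite /dot (pvm_proj pvm mB).2. Qed.

Lemma pvm_idem B f : measurable B -> E B (E B f) = E B f.
Proof. by move=> mB; exact: (pvm_proj pvm mB).1. Qed.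

Lemma pvm_disjoint A B f : measurable A -> measurable B -> A `&` B = set0 ->
  E A (E B f) = 0.
Proof. by move=> mA mB AB; rewrite -(pvm_setI pvm)// AB (pvm_set0 pvm). Qed.

Lemma pvm_sub A B f : measurable A -> measurable B -> A `<=` B ->
  E A (E B f) = E A f.
Proof. by move=> mA mB AB; rewrite -(pvm_setI pvm)// (setIidl AB). Qed.

Lemma pvm_dot_self B f : measurable B -> dot (E B f) f = dot (E B f) (E B f).
Proof. by move=> mB; rewrite [RHS]pvm_dot// pvm_idem// pvm_dot. Qed.

Lemma diag_measureE f (nu : {measure set (measurableTypeR R) -> \bar R}) :
  (forall B, measurable B -> nu B = diag_measure E f B) ->
  forall B, measurable B -> nu B = (dot (E B f) f)%:E.
Proof. by move=> nuE B mB; rewrite nuE. Qed.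

Lemma spectral_measureP f : exists2 nu : {measure set (measurableTypeR R) -> \bar R},
  (forall B, measurable B -> nu B = (dot (E B f) f)%:E) &
  dot (T f) f = \int[nu]_t t.
Proof.
have [nu nuE Tf] := HE.2 f; exists nu; first exact: diag_measureE.
by rewrite /dot Tf.
Qed.

(** The defect [g] is fixed by [E (A]|[B)] and killed by [E A] and [E B]. Its own measure is
    additive, so [|g|^2 = nu (A]|[B) = nu A + nu B = 0]. *)
Lemma pvmU A B f : measurable A -> measurable B -> A `&` B = set0 ->
  E (A `|` B) f = E A f + E B f.
Proof.
move=> mA mB AB; have mAB := measurableU _ _ mA mB.
apply/eqP; rewrite -subr_eq0; apply/eqP; set g := _ - _.
have sA : A `<=` A `|` B by move=> x; left.
have sB : B `<=` A `|` B by move=> x; right.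
have gA : E A g = 0.
  by rewrite /g linearB linearD pvm_sub// pvm_idem// pvm_disjoint// addr0 subrr.
have gB : E B g = 0.
  rewrite /g linearB linearD pvm_sub// pvm_idem// (pvm_disjoint _ mB mA) 1?setIC//.
  by rewrite add0r subrr.
have gAB : E (A `|` B) g = g.
  rewrite /g linearB linearD pvm_idem// -!(pvm_setI pvm)//.
  by rewrite !(setIC (_ `|` _)) !setIidl.
have [nu nuE _] := spectral_measureP g.
apply: dot_eq0; rewrite -{1}gAB; apply: EFin_inj; rewrite -nuE//.
have nuA : nu A = 0%E by rewrite nuE// gA dot0l.
have nuB : nu B = 0%E by rewrite nuE// gB dot0l.
rewrite measureU//; change (nu A + nu B = 0)%E.
by rewrite nuA nuB adde0.
Qed.

Lemma measurable_EFin_id :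
  @measurable_fun _ _ (measurableTypeR R) (\bar R) setT (EFin \o @id R).
Proof. by apply/measurable_EFinP => _ Y mY; rewrite setTI. Qed.

Lemma integrable_bounded_support (nu : {measure set (measurableTypeR R) -> \bar R})
    (M : R) : (nu setT < +oo)%E -> nu (~` [set` `[- M, M]]) = 0%E ->
  nu.-integrable setT (EFin \o @id R).
Proof.
move=> nufin nu0.
have mI : measurable ([set` `[- M, M]] : set (measurableTypeR R)) by exact: measurable_itv.
apply/(negligible_integrable (measurableC mI)) => //.
  exact: measurable_EFin_id.
rewrite setTD setCK; apply: measurable_bounded_integrable => //.
- by apply: le_lt_trans nufin; apply: le_measure => //; rewrite inE.
- exists `|M|; split => // x Mx t /=; rewrite in_itv/= => /andP[t1 t2].
  apply/ltW; apply: le_lt_trans Mx; rewrite ler_norml.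
  by rewrite (le_trans t2 (ler_norm _)) andbT; apply: le_trans t1; rewrite lerN2 ler_norm.
Qed.

Lemma spectral_integrable f (nu : {measure set (measurableTypeR R) -> \bar R}) :
  (forall B, measurable B -> nu B = (dot (E B f) f)%:E) ->
  nu.-integrable setT (EFin \o @id R).
Proof.
move=> nuE; have [M EM] := pvm_bounded pvm.
have mI : measurable ([set` `[- M, M]] : set (measurableTypeR R)) by exact: measurable_itv.
apply: (@integrable_bounded_support nu M); first by rewrite nuE// ltry.
rewrite nuE; last exact: measurableC.
by rewrite -(EM f) pvm_disjoint ?dot0l//; [exact: measurableC|rewrite setICl].
Qed.

(** The measure of [f] is carried by [B], where the integrand is at least [c], and has total mass
    [dot f f]. *)
Lemma spectral_ge B (c : R) f : measurable B -> B `<=` [set t | c <= t] ->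
  E B f = f -> c * dot f f <= dot (T f) f.
Proof.
move=> mB Bc EB; have [nu nuE ->] := spectral_measureP f.
have int := spectral_integrable nuE.
have mB1 : measurable (B : set (measurableTypeR R)) by [].
have mB' := measurableC mB1.
have nu0 : nu (~` B) = 0%E.
  by rewrite nuE// -EB pvm_disjoint ?dot0l// setICl.
rewrite /Rintegral (negligible_integral mB' (@measurableT _ (measurableTypeR R)) int nu0) setTD setCK.
have intB : nu.-integrable B (EFin \o @id R) by apply: integrableS int.
have fB : (nu B < +oo)%E by rewrite nuE// ltry.
rewrite [leLHS](_ : _ = \int[nu]_(x in B) c)%R; last first.
  by rewrite Rintegral_cst// nuE//= EB.
apply: (@le_Rintegral _ _ _ nu B (cst c) id) => //.
apply: measurable_bounded_integrable => //.
by exists `|c|; split => // x cx t _; exact: ltW.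
Qed.

Lemma spectral_le B (c : R) f : measurable B -> B `<=` [set t | t <= c] ->
  E B f = f -> dot (T f) f <= c * dot f f.
Proof.
move=> mB Bc EB; have [nu nuE ->] := spectral_measureP f.
have int := spectral_integrable nuE.
have mB1 : measurable (B : set (measurableTypeR R)) by [].
have mB' := measurableC mB1.
have nu0 : nu (~` B) = 0%E.
  by rewrite nuE// -EB pvm_disjoint ?dot0l// setICl.
rewrite /Rintegral (negligible_integral mB' (@measurableT _ (measurableTypeR R)) int nu0) setTD setCK.
have intB : nu.-integrable B (EFin \o @id R) by apply: integrableS int.
have fB : (nu B < +oo)%E by rewrite nuE// ltry.
rewrite [leRHS](_ : _ = \int[nu]_(x in B) c)%R; last first.
  by rewrite Rintegral_cst// nuE//= EB.
apply: (@le_Rintegral _ _ _ nu B id (cst c)) => //.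
apply: measurable_bounded_integrable => //.
by exists `|c|; split => // x cx t _; exact: ltW.
Qed.

(* For [u = E(A) f] and [w = E(B) g] the measure of [u + w] is the sum of the
   measures of [u] and [w], so the cross terms of [(T (u + w), u + w)] vanish. *)
Lemma spectral_dot0 A B f g : measurable A -> measurable B -> A `&` B = set0 ->
  dot (T (E A f)) (E B g) = 0.
Proof.
move=> mA mB AB; set u := E A f; set w := E B g.
have uE : E A u = u by rewrite /u pvm_idem.
have wE : E B w = w by rewrite /w pvm_idem.
have uw C : measurable C -> dot (E C u) w = 0.
  move=> mC; rewrite -wE -pvm_dot// -{1}uE -!(pvm_setI pvm); do ?[exact: mA|exact: mB|exact: mC|apply: measurableI].
  by rewrite setIAC (setIC B) AB !set0I (pvm_set0 pvm) dot0l.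
have [nu nuE Tu] := spectral_measureP u.
have [om omE Tw] := spectral_measureP w.
have [rh rhE Tuw] := spectral_measureP (u + w).
have inu := spectral_integrable nuE; have iom := spectral_integrable omE.
have sum : dot (T (u + w)) (u + w) = dot (T u) u + dot (T w) w.
  rewrite Tuw Tu Tw /Rintegral -fineD ?integrable_fin_num//.
  rewrite -integral_measure_add//.
  congr fine; apply: eq_measure_integral => C mC _.
  apply: (etrans (rhE C mC)); apply: (etrans _ (esym (measure_addE nu om C))).
  apply: (etrans _ (esym (congr2 (fun a b => a + b)%E (nuE C mC) (omE C mC)))).
  rewrite -EFinD; congr EFin.
  by rewrite linearD !dot_lin uw// (pvm_dot w)// (dotC w) uw//; ring.
(* By symmetry of [T] the two cross terms are equal, so their vanishing sum makes each of them 0. *)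
move: sum; rewrite linearD !dot_lin (Tsym w) (dotC w) => sum.
by have : dot (T u) w = 0 by lra.
Qed.

Lemma pvm_norm B f : measurable B -> ell2_norm (E B f) <= ell2_norm f.
Proof.
move=> mB; rewrite ell2_norm_le ?ell2_norm_ge0// sqr_ell2_norm.
have := dot_ge0 (f - E B f).
rewrite !dot_lin (dotC f (E B f)) pvm_dot_self//; lra.
Qed.

Lemma pvm_ker_closed B : measurable B -> closed_subspace [set f | E B f = 0].
Proof.
move=> mB; split=> /= [|f g c f0 g0|f H]; first by rewrite linear0.
  by rewrite linearD linearZ /= f0 g0 scaler0 addr0.
apply: ell2_norm_eq0; apply/le_anti; rewrite ell2_norm_ge0 andbT.
apply/ler_addgt0Pl => e /H[g g0 fg]; rewrite addr0; apply: le_trans fg.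
by apply: le_trans (pvm_norm _ mB); rewrite linearB g0 subr0.
Qed.

Lemma pvmC B f : measurable B -> f = E B f + E (~` B) f.
Proof.
move=> mB; have mC := measurableC mB.
by rewrite -pvmU ?setICr// setUv (pvm_setT pvm).
Qed.

Lemma pvm_ker_stable B f : measurable B -> E B f = 0 -> E B (T f) = 0.
Proof.
move=> mB f0; apply: dot_eq0; rewrite -pvm_dot_self// dotC.
rewrite {1}(pvmC f mB) f0 add0r spectral_dot0//; first exact: measurableC.
by rewrite setICl.
Qed.

(** Let [u] and [w] be the parts of [f] below and above the gap. They are orthogonal, also after
    applying [T], so pairing [(T - s) f] with [w - u], which has the norm of [f], gives at least
    [eps |f|^2]. *)
Lemma spectral_gap (s eps : R) f : 0 < eps ->
  E [set` `]s - eps, s + eps[] f = 0 ->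
  eps * ell2_norm f <= ell2_norm (T f - s%:C *: f).
Proof.
move=> e0; set V := [set` _] => f0.
pose N : set R := [set` `]-oo, s - eps]]; pose P : set R := [set` `[s + eps, +oo[].
have mV : measurable V by exact: measurable_itv.
have mN : measurable N by exact: measurable_itv.
have mP : measurable P by exact: measurable_itv.
have NP : N `&` P = set0.
  by apply/seteqP; split=> // t []; rewrite /N /P /= !in_itv/= => ? /andP[? _]; lra.
have VC : ~` V = N `|` P.
  apply/seteqP; split=> t /=; rewrite /N /P /V /= !in_itv/= andbT.
    move=> /negP; rewrite negb_and -!leNgt => /orP[]; [by left|by right].
  by move=> [] ? /andP[? ?]; lra.
have fE : f = E N f + E P f by rewrite -pvmU// -VC {1}(pvmC f mV) f0 add0r.
set u := E N f in fE; set w := E P f in fE.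
have Tuw : dot (T u) w = 0 by rewrite spectral_dot0.
have uw : dot u w = 0 by rewrite /u /w pvm_dot// pvm_disjoint// dot0r.
have hu : dot (T u) u <= (s - eps) * dot u u.
  by apply: (@spectral_le N) => //; exact: pvm_idem.
have hw : (s + eps) * dot w w <= dot (T w) w.
  apply: (@spectral_ge P) => //; last exact: pvm_idem.
  by move=> t; rewrite /P /= in_itv/= andbT.
have Twu : dot (T w) u = 0 by rewrite Tsym dotC.
have e2 : 0 <= eps * (dot (T w) w - (s + eps) * dot w w).
  by rewrite mulr_ge0 ?(ltW e0)// subr_ge0.
have e3 : 0 <= eps * ((s - eps) * dot u u - dot (T u) u).
  by rewrite mulr_ge0 ?(ltW e0)// subr_ge0.
set g := T f - _.
suff : eps ^+ 2 * dot f f <= dot g g.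
  by rewrite -!sqr_ell2_norm -exprMn ler_pXn2r ?nnegrE ?mulr_ge0 ?ell2_norm_ge0 ?(ltW e0).
(* This square yields [|g|^2 >= 2 eps dot g (w - u) - eps^2 |f|^2 >= eps^2 |f|^2]. *)
have := dot_ge0 (g - eps%:C *: (w - u)).
have gw : dot g w = dot (T w) w - s * dot w w.
  by rewrite /g fE linearD !dot_lin Tuw uw; ring.
have gu : dot g u = dot (T u) u - s * dot u u.
  by rewrite /g fE linearD !dot_lin Twu (dotC w) uw; ring.
have ff : dot f f = dot u u + dot w w.
  by rewrite fE !dot_lin (dotC w) uw; ring.
clearbody g; rewrite !dot_lin (dotC w g) (dotC u g) (dotC w u) gw gu uw ff; lra.
Qed.

End SpectralMeasure.

(** * The operators [T - z]: invariant subspaces, and invertibility off [[- M, M]] *)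

Section ShiftedOperator.
Variables (R : realType) (I : choiceType).
Local Notation L := (ell2 R I).
Variable T : {linear L -> L}.
Hypothesis Tsym : forall f g, dot (T f) g = dot f (T g).
Implicit Types (f g : L) (z : R[i]).

Definition shift z : {linear L -> L} := T \- z \*: @idfun L.

Lemma shiftE z f : shift z f = T f - z *: f.
Proof. by []. Qed.

Lemma shift_adj z f g : dot (shift z f) g = dot f (shift z^* g).
Proof. by rewrite !shiftE !dot_lin Tsym dotZ_conj. Qed.

Lemma ell2_normZC z f : ell2_norm (z *: f) = Num.sqrt (sqmod z) * ell2_norm f.
Proof. by rewrite ell2_normE dotZZ sqrtrM ?sqmod_ge0. Qed.

Lemma conjc_sqmod z : sqmod z^* = sqmod z.
Proof. by case: z => a b; rewrite /sqmod /= sqrrN. Qed.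

Variable M : R.
Hypothesis M0 : 0 <= M.
Hypothesis TM : forall f, ell2_norm (T f) <= M * ell2_norm f.

(** The added 1 makes the constant strictly positive, as the Landweber lemmas require of [K]. *)
Lemma shift_bound z f :
  ell2_norm (shift z f) <= (M + Num.sqrt (sqmod z) + 1) * ell2_norm f.
Proof.
rewrite shiftE; apply: le_trans (ell2_normD _ _) _.
rewrite ell2_normN ell2_normZC; have := TM f; have := ell2_norm_ge0 f; lra.
Qed.

(** This is [landweber_stable] for [T - s] on the kernel of the spectral projection: that kernel is
    stable under [T], and the gap supplies the lower bound. Adding [s h] back turns [T - s] into
    [T]. *)
Lemma spectral_gap_invariant (E : set R -> {linear L -> L}) (s eps : R)
    (Z : set L) : is_spectral_measure T E -> 0 < eps ->
  closed_subspace Z -> Z `<=` [set f | E [set` `]s - eps, s + eps[] f = 0] ->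
  (forall f, E [set` `]s - eps, s + eps[] f = 0 -> Z (T f - s%:C *: f) -> Z f) ->
  forall h, Z h -> Z (T h).
Proof.
move=> HE e0 cZ ZX DZ h Zh; set V := [set` _] in ZX DZ.
have mV : measurable V by exact: measurable_itv.
have sC : (s%:C)^* = s%:C :> R[i] by rewrite /= /conjc oppr0.
have [Z0 Zlin Zcl] := cZ.
have : Z (shift s%:C h).
  apply: (landweber_stable e0 _ (pvm_ker_closed HE mV) cZ ZX _ _
    (shift_bound s%:C)) => //.
  - by rewrite ltr_wpDl// addr_ge0 ?sqrtr_ge0.
  - by move=> f g; rewrite shift_adj sC.
  - by move=> f /= f0; rewrite linearB linearZ /= f0 scaler0 subr0 (pvm_ker_stable Tsym HE mV).
  - by move=> f f0; exact: (spectral_gap Tsym HE e0 f0).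
rewrite shiftE => Zs; have := Zlin _ _ s Zs Zh.
by rewrite subrK.
Qed.

(** For real [z] outside [[- M, M]] this is the triangle inequality. For [z = p + i q] with [q]
    nonzero, [(T - p) f] and [i q f] are orthogonal for [dot], so the norm is at least [|q| |f|]. *)
Lemma shift_lower z :
  (forall t, t \in `[- M, M] -> t%:C <> z) ->
  exists2 eps : R, 0 < eps & forall f, eps * ell2_norm f <= ell2_norm (shift z f).
Proof.
case: z => p q zN; have [q0|qN0] := eqVneq q 0.
  have pM : M < `|p|.
    rewrite ltNge; apply/negP => pM; apply: (zN p); last by rewrite q0.
    by rewrite in_itv/= -ler_norml.
  exists (`|p| - M) => [|f]; first by rewrite subr_gt0.
  rewrite q0 shiftE -/(p%:C) mulrBl -ell2_normZ lerBlDr.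
  have e : T f + (p%:C *: f - T f) = p%:C *: f by rewrite addrCA subrr addr0.
  have := ell2_normD (T f) (p%:C *: f - T f); rewrite e.
  by rewrite (ell2_norm_subC (p%:C *: f)); have := TM f; lra.
exists `|q| => [|f]; first by rewrite normr_gt0.
rewrite -ell2_normZ; apply: ler_wsqrtr.
rewrite -/(dot _ _) -/(dot _ _).
pose g := shift p%:C f.
pose ji : R[i] := 0 +i* q.
have pj : p +i* q = p%:C + ji by rewrite /ji; simpc.
have ci : ji^* = - ji by apply/eqP; rewrite eq_complex /= oppr0 !eqxx.
have sj : sqmod ji = q ^+ 2 by rewrite /sqmod /= expr0n add0r.
have pC : (p%:C)^* = p%:C :> R[i] by rewrite /= /conjc oppr0.
clearbody ji.
have -> : shift (p +i* q) f = g - ji *: f.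
  by rewrite /g !shiftE pj scalerDl opprD addrA.
(* The product equals its own opposite: [T - p] is symmetric while multiplication by [ji] is
   skew. *)
have g0 : dot g (ji *: f) = 0.
  have gZ : shift p%:C (ji *: f) = ji *: g by exact: linearZ.
  have e1 : dot g (ji *: f) = dot f (ji *: g) by rewrite {1}/g shift_adj pC gZ.
  have e2 : dot (ji *: g) f = - dot g (ji *: f).
    rewrite dotZ_conj -dotNr -scaleNr; congr (dot g (_ *: f)); exact: ci.
  by rewrite (dotC f) e2 in e1; lra.
clearbody g; rewrite !dot_lin (dotC _ g) g0 !dotZZ sj.
have := dot_ge0 g; lra.
Qed.

(** Off the interval, the lower bound on [T - z] gives injectivity and a bounded inverse, and the
    lower bound on its adjoint [T - z^*] gives surjectivity by [landweber_surj]. *)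
Lemma spectrum_subset : spectrum T `<=` [set t%:C | t in [set` `[- M, M]]].
Proof.
move=> z zS; apply: contrapT => zN.
have zN1 t : t \in `[- M, M] -> t%:C <> z by move=> tM tz; apply: zN; exists t.
have zN2 t : t \in `[- M, M] -> t%:C <> z^*.
  move=> tM tz; apply: zN; exists t => //.
  by rewrite -[z]conjcK -tz /= oppr0.
have [e1 e10 He1] := shift_lower zN1; have [e2 e20 He2] := shift_lower zN2.
have cT : closed_subspace [set: L] by [].
have /choice[S HS] g : exists f, shift z f = g.
  have K0 : 0 < M + Num.sqrt (sqmod z) + 1 by rewrite ltr_wpDl// addr_ge0 ?sqrtr_ge0.
  have bd : forall f, ell2_norm (shift z^* f) <= (M + Num.sqrt (sqmod z) + 1) * ell2_norm f.
    by rewrite -(conjc_sqmod z); exact: shift_bound.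
  have [f _ <-] := landweber_surj e20 K0 cT (shift_adj z) (fun _ _ => Logic.I)
    (fun _ _ => Logic.I) (shift_bound z) bd (fun f _ => He2 f) (Logic.I : setT g).
  by exists f.
have inj f g : shift z f = shift z g -> f = g.
  move=> fg; apply/eqP; rewrite -subr_eq0; apply/eqP/ell2_norm_eq0.
  apply/le_anti; rewrite ell2_norm_ge0 andbT -(ler_pM2l e10) mulr0.
  by apply: le_trans (He1 _) _; rewrite linearB fg subrr ell2_norm0.
have Slin : linear S.
  by move=> c f g; apply: inj; rewrite linearP !HS.
pose S' : {linear L -> L} := HB.pack S (GRing.isLinear.Build R[i] L L _ S Slin).
apply: zS; exists S'; split.
- exists e1^-1 => f; rewrite ler_pdivlMl//.
  by apply: le_trans (He1 _) _; rewrite HS.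
- by move=> f; apply: inj; rewrite HS.
- by move=> f; rewrite -[RHS]HS.
Qed.

End ShiftedOperator.

(** * Square summable solutions of the three-term recurrence *)

Section ThreeTermRecurrence.
Variable R : realType.

Lemma linear_bounded_le0 (q B : R) : (forall n : nat, n%:R * q <= B) -> q <= 0.
Proof.
move=> H; rewrite leNgt; apply/negP => q0.
have := archi_boundP (normr_ge0 (B / q)); set n := Num.bound _ => nB.
have := H n; rewrite -ler_pdivlMr// => /(lt_le_trans nB).
by rewrite ltNge ler_norm.
Qed.

(* [u_k^2 + u_(k+1)^2 - c u_k u_(k+1)] does not depend on [k], and vanishes
   because it is dominated by the terms of a convergent series. *)
Lemma recurrence_sq_summable (c B : R) (u : nat -> R) : `|c| <= 2 ->
  (forall k, u k.+2 = c * u k.+1 - u k) ->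
  (forall n, \sum_(k < n) u k ^+ 2 <= B) ->
  forall k, u k = 0.
Proof.
rewrite ler_norml => /andP[c1 c2] rec uB.
pose Q k := u k ^+ 2 + u k.+1 ^+ 2 - c * (u k * u k.+1).
have QS k : Q k = Q 0.
  elim: k => // k <-; rewrite /Q rec; ring.
have c4 : c ^+ 2 <= 4 by nra.
have Qle k : Q k <= 2 * (u k ^+ 2 + u k.+1 ^+ 2).
  have := sqr_ge0 (u k - u k.+1); have := sqr_ge0 (u k + u k.+1); rewrite /Q; nra.
have Qge k : 0 <= Q k.
  have := sqr_ge0 (u k - u k.+1); have := sqr_ge0 (u k + u k.+1); rewrite /Q; nra.
(* Summing the constant [Q] over [n] indices gives at most [4 B], as each square occurs in two
   consecutive terms with factor 2. *)
have Q0 : Q 0 = 0.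
  apply/le_anti; rewrite Qge andbT; apply: (@linear_bounded_le0 _ (4 * B)) => n.
  have -> : n%:R * Q 0 = \sum_(k < n) Q k.
    by rewrite (eq_bigr _ (fun (k : 'I_n) _ => QS k)) sumr_const card_ord mulr_natl.
  apply: (@le_trans _ _ (\sum_(k < n) 2 * (u k ^+ 2 + u k.+1 ^+ 2))).
    by apply: ler_sum => k _; exact: Qle.
  rewrite -mulr_sumr big_split/=.
  have h1 := uB n; have := uB n.+1; rewrite big_ord_recl/=.
  by under eq_bigr do rewrite /bump/= add1n; have := sqr_ge0 (u 0); lra.
(* Squaring [p^2 + q^2 = c p q] and using [c^2 <= 4] gives [(p^2 - q^2)^2 <= 0]. So the squares are
   constant, and their bounded partial sums force them to be 0; the boundary values of [c] are
   included. *)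
have usq k : u k.+1 ^+ 2 = u k ^+ 2.
  have := QS k; rewrite Q0 /Q => /eqP; rewrite subr_eq0 => /eqP e.
  apply/eqP; rewrite -subr_eq0 -sqrf_eq0 eq_le sqr_ge0 andbT.
  have e2 : (u k ^+ 2 + u k.+1 ^+ 2) ^+ 2 = c ^+ 2 * (u k ^+ 2 * u k.+1 ^+ 2).
    by rewrite e; ring.
  have : 0 <= (4 - c ^+ 2) * (u k ^+ 2 * u k.+1 ^+ 2).
    by rewrite mulr_ge0 ?subr_ge0// mulr_ge0 ?sqr_ge0.
  lra.
have ue k : u k ^+ 2 = u 0 ^+ 2 by elim: k => // k <-.
move=> k; apply/eqP; rewrite -sqrf_eq0 ue eq_le sqr_ge0 andbT.
apply: (@linear_bounded_le0 _ B) => n; apply: le_trans (uB n).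
by rewrite (eq_bigr _ (fun (k : 'I_n) _ => ue k)) sumr_const card_ord mulr_natl.
Qed.

End ThreeTermRecurrence.

(** * Operators acting along a ray as a multiple of its adjacency operator *)

Section Ray.
Variables (R : realType) (I : choiceType).
Local Notation L := (ell2 R I).
Variables (T : {linear L -> L}) (gamma : R) (v : nat -> I).
Hypothesis gamma0 : gamma != 0.
Hypothesis v_inj : injective v.
Hypothesis Tv : forall f k,
  T f (v k.+1) = gamma%:C * (f (v k.+2) + f (v k)).

(** Injectivity is asked below [n] only, to allow [w i = v (j - i)], which truncated subtraction
    makes constant from [j] on. *)
Lemma sum_ray_le (f : L) (w : nat -> I) n :
  {in [pred k | (k < n)%N] &, injective w} ->
  \sum_(k < n) sqmod (f (w k)) <= dot f f.
Proof.
move=> w_inj.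
rewrite -(big_mkord xpredT (fun k => sqmod (f (w k)))).
rewrite -(big_map w xpredT (fun i => sqmod (f i))); apply: sum_sqmod_le.
rewrite map_inj_in_uniq ?iota_uniq// => i j.
by rewrite !mem_index_iota => ? ?; exact: w_inj.
Qed.

Lemma ray_recurrence (s : R) (f : L) k :
  complex.Re (f (v k.+2)) = s / gamma * complex.Re (f (v k.+1))
    - complex.Re (f (v k)) + complex.Re ((T f - s%:C *: f : L) (v k.+1)) / gamma
  /\ complex.Im (f (v k.+2)) = s / gamma * complex.Im (f (v k.+1))
    - complex.Im (f (v k)) + complex.Im ((T f - s%:C *: f : L) (v k.+1)) / gamma.
Proof.
rewrite [(T f - _ : L) _](_ : _ = T f (v k.+1) - s%:C * f (v k.+1))// Tv.
case: (f (v k.+2)) (f (v k.+1)) (f (v k)) => [a b] [c d] [e h] /=.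
by split; field.
Qed.

(** The equation at [v k] with [k > j] is the recurrence centred at [k], with coefficient
    [s / gamma] in [[-2, 2]]; the first value it involves is [f (v j)]. Real and imaginary parts are
    treated separately. *)
Lemma ray_vanish (s : R) (f : L) j : `|s| <= 2 * `|gamma| ->
  (forall k, (j < k)%N -> (T f - s%:C *: f : L) (v k) = 0) ->
  forall k, (j <= k)%N -> f (v k) = 0.
Proof.
move=> sg H k jk; have c2 : `|s / gamma| <= 2.
  by rewrite normrM normfV ler_pdivrMr ?normr_gt0.
have sumB n : \sum_(i < n) sqmod (f (v (j + i)%N)) <= dot f f.
  by apply: (@sum_ray_le f (fun i => v (j + i)%N)) => i i' _ _ /v_inj/addnI.
have H' i : (T f - s%:C *: f : L) (v (j + i).+1) = 0.
  by apply: H; rewrite ltnS leq_addr.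
have re : complex.Re (f (v k)) = 0.
  rewrite -(subnKC jk).
  apply: (@recurrence_sq_summable _ _ (dot f f) (fun i => complex.Re (f (v (j + i)%N))) c2).
    by move=> i; rewrite !addnS (ray_recurrence s f _).1 H' mul0r addr0.
  move=> n; apply: le_trans (sumB n); apply: ler_sum => i _.
  by rewrite lerDl sqr_ge0.
have im : complex.Im (f (v k)) = 0.
  rewrite -(subnKC jk).
  apply: (@recurrence_sq_summable _ _ (dot f f) (fun i => complex.Im (f (v (j + i)%N))) c2).
    by move=> i; rewrite !addnS (ray_recurrence s f _).2 H' mul0r addr0.
  move=> n; apply: le_trans (sumB n); apply: ler_sum => i _.
  by rewrite lerDr sqr_ge0.
by case: (f (v k)) re im => a b /= -> ->.
Qed.

Lemma dot_delta (z : I) : dot (delta z : L) (delta z) = 1.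
Proof.
rewrite dot_self (_ : esum _ _ = \esum_(i in [set z]) (1 : R)%:E)%E.
  by rewrite esum_set1 ?lee_fin.
rewrite [RHS]esum_mkcond; apply: eq_esum => i _.
rewrite /sqmod; case: ifPn => [/set_mem ->|/negP iz].
  by rewrite /= eqxx /= expr1n expr0n addr0.
have /negPf iz' : i != z by apply/eqP => e; apply: iz; apply: mem_set.
by rewrite /= iz' /= expr0n addr0.
Qed.

(** For positive [k] this is [gamma^-1 U_(k-1) (s / (2 gamma))], with [U] the Chebyshev polynomials
    of the second kind. *)
Fixpoint ray_green (s : R) (k : nat) : R :=
  match k with
  | 0 => 0
  | 1 => gamma^-1
  | (k'.+1 as k1).+1 => s / gamma * ray_green s k1 - ray_green s k'
  end.

(* Solving [(T - s) f = delta (v j)] downwards from [v j] gives values of [f]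
   that are independent of [j] and not square summable. *)
Lemma ray_spectrum (s : R) : `|s| <= 2 * `|gamma| -> spectrum T s%:C.
Proof.
move=> sg [S [[B SB] _ TS]].
have c2 : `|s / gamma| <= 2 by rewrite normrM normfV ler_pdivrMr ?normr_gt0.
(* This will contradict the value [gamma^-1]. The bound [B^2] on the partial sums is uniform in [j],
   since [S] is bounded by [B] and each [delta (v j)] has norm 1. *)
have g0 : ray_green s 1 = 0.
  apply: (@recurrence_sq_summable _ (s / gamma) (B ^+ 2) (ray_green s) c2) => // -[|j].
    by rewrite big_ord0 sqr_ge0.
  pose f := S (delta (v j)); have Tf : T f - s%:C *: f = delta (v j) by exact: TS.
  have fj k : (j <= k)%N -> f (v k) = 0.
    apply: (@ray_vanish s) => // i ji.
    by rewrite Tf /= (inj_eq v_inj) gtn_eqF.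
  (* The equation at [v j] produces the value [gamma^-1] at [v (j - 1)], and the later ones continue
     the recurrence down to [v 0]. Two consecutive values are carried because the recurrence has
     order two. *)
  have fg i : (i <= j)%N -> complex.Re (f (v (j - i)%N)) = ray_green s i
      /\ ((i < j)%N -> complex.Re (f (v (j - i.+1)%N)) = ray_green s i.+1).
    elim: i => [_|i IH ij].
      rewrite subn0 fj//; split=> // j0; have := (ray_recurrence s f j.-1).1.
      have dj : complex.Re ((delta (v j) : L) (v j)) = 1 by rewrite /= eqxx.
      rewrite !prednK// Tf (fj _ (leqnSn j)) (fj _ (leqnn j)) dj subn1 /=.
      by rewrite mulr0 sub0r mul1r => /eqP; rewrite eq_sym addrC subr_eq0 => /eqP.
    have [h1 h2] := IH (ltnW ij); split; first exact: h2.
    move=> ij'; have := (ray_recurrence s f (j - i.+2)%N).1.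
    have e1 : ((j - i.+2).+1 = j - i.+1)%N by rewrite subnSK.
    have e2 : ((j - i.+2).+2 = j - i)%N by rewrite e1 subnSK.
    have d0 : complex.Re ((delta (v j) : L) (v (j - i.+1)%N)) = 0.
      by rewrite /= (inj_eq v_inj) ltn_eqF// ltn_subrL (leq_ltn_trans _ ij).
    rewrite e2 e1 h1 h2// Tf d0 mul0r addr0 => e.
    rewrite -[RHS]/(s / gamma * ray_green s i.+1 - ray_green s i) e.
    by move: (ray_green s i.+1) => u; ring.
  apply: (@le_trans _ _ (dot f f)).
    apply: le_trans (@sum_ray_le f (fun i => v (j - i)%N) j.+1 _).
      apply: ler_sum => i _; rewrite -(fg i (leq_ord i)).1.
      by rewrite lerDl sqr_ge0.
    move=> i i' /=; rewrite !inE !ltnS => ij ij' /v_inj e.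
    by rewrite -(subKn ij) e subKn.
  rewrite -sqr_ell2_norm; have := SB (delta (v j)); rewrite -/f.
  rewrite [ell2_norm (delta _)]ell2_normE dot_delta sqrtr1 mulr1 => fB.
  by apply: lerXn2r (fB); rewrite nnegrE ?ell2_norm_ge0// (le_trans (ell2_norm_ge0 _) fB).
by move/eqP: g0; rewrite /= invr_eq0 (negPf gamma0).
Qed.

End Ray.

(** * The ray of the points [a^-n x] in the orbit of [x] *)

Section Orbit.
Variables (R : realType) (x : I01 R).

Lemma act_aK : cancel (@act_a R x) (@act_ai R x).
Proof. by apply: orbit_actK; exact: map_aK. Qed.
Lemma act_aiK : cancel (@act_ai R x) (@act_a R x).
Proof. by apply: orbit_actK; exact: map_aiK. Qed.
Lemma act_bK : cancel (@act_b R x) (@act_bi R x).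
Proof. by apply: orbit_actK; exact: map_bK. Qed.
Lemma act_biK : cancel (@act_bi R x) (@act_b R x).
Proof. by apply: orbit_actK; exact: map_biK. Qed.

Hypothesis x01 : 0 < val x < 1.

Let y (n : nat) : R := iter n (@ai_fun R) (val x).

Lemma ai_fun_itv (t : R) : 0 < t < 1 -> t < ai_fun t < 1.
Proof.
by rewrite /ai_fun => /andP[? ?]; case: (ltP t (1 / 4)) => ?; [|case: (ltP t (1 / 2)) => ?];
  by apply/andP; split; lra.
Qed.

Let y01 n : 0 < y n < 1.
Proof.
elim: n => // n /[dup]/andP[h _] /ai_fun_itv/andP[h1 h2]; rewrite /y iterS.
by rewrite (lt_trans h h1) h2.
Qed.

Let y_incr : {homo y : m n / (m < n)%N >-> m < n}.
Proof.
apply: homo_ltn; first exact: lt_trans.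
by move=> n; rewrite /y iterS; case/andP: (ai_fun_itv (y01 n)).
Qed.

(* The odds [t / (1 - t)] at least double under [a^-1]. *)
Lemma ai_fun_odds (c t : R) : 0 <= c -> 0 < t < 1 -> c * (1 - t) <= t ->
  2 * c * (1 - ai_fun t) <= ai_fun t.
Proof.
move=> c0 /andP[t0 t1] ct; have c1 : 0 <= c * t by rewrite mulr_ge0// ltW.
rewrite /ai_fun; case: (ltP t (1 / 4)) => ?; [|case: (ltP t (1 / 2)) => ?]; nra.
Qed.

(** The odds start at least at [x] and double, so after [n] steps they are at least [2^n x]. Once
    this reaches 8, [y n] is at least [8 / 9]. *)
Lemma ray_start : exists N, forall n, (N <= n)%N -> 7 / 8 <= y n.
Proof.
have /andP[x0 x1] := x01.
have od n : 2 ^+ n * val x * (1 - y n) <= y n.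
  elim: n => [|n IH]; first by rewrite mul1r /y /=; nra.
  rewrite exprS -(mulrA 2 (2 ^+ n)) /y iterS; apply: ai_fun_odds => //.
  - by rewrite mulr_ge0 ?exprn_ge0// ltW.
  - exact: y01.
have := archi_boundP (normr_ge0 (8 / val x)); set N := Num.bound _ => xN.
exists N => n Nn; have h8 : 8 <= 2 ^+ n * val x.
  rewrite -ler_pdivrMr//; apply: le_trans (ler_norm _) _; apply: ltW.
  apply: lt_le_trans xN _; rewrite -natrX ler_nat.
  by apply: leq_trans Nn _; rewrite ltnW// ltn_expl.
have /andP[_ y1] := y01 n; have := od n.
have : 8 * (1 - y n) <= 2 ^+ n * val x * (1 - y n).
  by rewrite ler_pM2r// subr_gt0.
lra.
Qed.

Lemma val_iter_act_ai n : val (val (iter n (@act_ai R x) (base_point x))) = y n.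
Proof. by elim: n => //= n ->. Qed.

Lemma iter_act_ai_inj : injective (fun n => iter n (@act_ai R x) (base_point x)).
Proof.
move=> m n /(congr1 (fun z => val (val z))); rewrite !val_iter_act_ai => mn.
by case: (ltngtP m n) => // /y_incr; rewrite mn ltxx.
Qed.

(** On [[3/4, 1]] both [a^-1] and [b^-1] are the map [t |-> (t + 1) / 2], and [ray_start] brings the
    ray there. *)
Lemma act_ai_eq_act_bi : exists N, forall n, (N <= n)%N ->
  act_bi (iter n (@act_ai R x) (base_point x)) =
  iter n.+1 (@act_ai R x) (base_point x).
Proof.
have [N HN] := ray_start; exists N; move=> n /HN yn.
apply/val_inj/val_inj; rewrite [RHS]val_iter_act_ai.
set p := iter n _ _; rewrite [LHS](_ : _ = bi_fun (val (val p)))// val_iter_act_ai.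
rewrite /y iterS -/(y n) /bi_fun ltNge (_ : 1 / 2 <= y n) /=; last by lra.
rewrite /ai_fun; case: (ltP (2 * y n - 1) (1 / 4)) => ?; first by lra.
case: (ltP (2 * y n - 1) (1 / 2)) => ?; first by lra.
case: (ltP (y n) (1 / 4)) => ?; first by lra.
by case: (ltP (y n) (1 / 2)) => ?; lra.
Qed.

End Orbit.

Arguments act_aK {R x}.
Arguments act_aiK {R x}.
Arguments act_bK {R x}.
Arguments act_biK {R x}.

(** * Symmetry, norm bound and positivity of [H], and its action along the ray *)

Section ThompsonOperator.
Variables (R : realType) (alpha beta : R) (x : I01 R).
Local Notation L := (ell2 R (Defs.orbit x)).
Local Notation H := (H_op alpha beta x : {linear L -> L}).

Let ra : L -> L := reindex_ell2 (Bijective act_aK act_aiK).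
Let rai : L -> L := reindex_ell2 (Bijective act_aiK act_aK).
Let rb : L -> L := reindex_ell2 (Bijective act_bK act_biK).
Let rbi : L -> L := reindex_ell2 (Bijective act_biK act_bK).

Let H_reindex f : H f = alpha%:C *: (rai f + ra f) + beta%:C *: (rbi f + rb f).
Proof. by apply: ell2_eqP. Qed.

Lemma dot_reindex_adj (e e' : Defs.orbit x -> Defs.orbit x) (ee' : cancel e e')
    (e'e : cancel e' e) (f g : L) :
  dot (reindex_ell2 (Bijective ee' e'e) f) g =
  dot f (reindex_ell2 (Bijective e'e ee') g).
Proof.
rewrite -[RHS](dot_reindex (Bijective ee' e'e)); congr dot.
by apply: ell2_eqP => i /=; rewrite ee'.
Qed.

Lemma H_sym (f g : L) : dot (H f) g = dot f (H g).
Proof.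
rewrite !H_reindex !dot_lin.
have ea : dot (ra f) g = dot f (rai g) by exact: dot_reindex_adj.
have eai : dot (rai f) g = dot f (ra g) by exact: dot_reindex_adj.
have eb : dot (rb f) g = dot f (rbi g) by exact: dot_reindex_adj.
have ebi : dot (rbi f) g = dot f (rb g) by exact: dot_reindex_adj.
by rewrite ea eai eb ebi; ring.
Qed.

(** [H] combines four reindexings by bijections, each of them an isometry. *)
Lemma H_bound (f : L) : ell2_norm (H f) <= 2 * (`|alpha| + `|beta|) * ell2_norm f.
Proof.
have nr e (be : bijective e) : ell2_norm (reindex_ell2 be f) = ell2_norm f.
  by rewrite !ell2_normE dot_reindex.
have n2 e e' (be : bijective e) (be' : bijective e') :
    ell2_norm (reindex_ell2 be f + reindex_ell2 be' f) <= 2 * ell2_norm f.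
  by apply: le_trans (ell2_normD _ _) _; rewrite !nr; lra.
rewrite H_reindex; apply: le_trans (ell2_normD _ _) _; rewrite !ell2_normZ.
have := ler_wpM2l (normr_ge0 alpha) (n2 _ _ (Bijective act_aiK act_aK) (Bijective act_aK act_aiK)).
have := ler_wpM2l (normr_ge0 beta) (n2 _ _ (Bijective act_biK act_bK) (Bijective act_bK act_biK)).
rewrite -/(rbi f) -/(rb f) -/(rai f) -/(ra f); lra.
Qed.

Lemma ReH (f : L) y : complex.Re (H f y) =
  alpha * (complex.Re (f (act_ai y)) + complex.Re (f (act_a y))) +
  beta * (complex.Re (f (act_bi y)) + complex.Re (f (act_b y))).
Proof.
rewrite [H f y](_ : _ = H_fun alpha beta f y)// /H_fun.
case: (f (act_ai y)) (f (act_a y)) (f (act_bi y)) (f (act_b y)) =>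
  [a1 a2] [b1 b2] [c1 c2] [d1 d2] /=; ring.
Qed.

(* The scalar [tau] absorbs the common sign of [alpha] and [beta]. *)
Lemma iter_H_pos n : 0 < alpha * beta ->
  exists tau : R, (forall y, 0 <= tau * complex.Re (iter n H (delta (base_point x)) y))
    /\ 0 < tau * complex.Re (iter n H (delta (base_point x)) (iter n (@act_ai R x) (base_point x))).
Proof.
move=> ab; elim: n => [|n [tau [t0 tp]]].
  exists 1; split=> [y|] /=; last by rewrite eqxx mul1r.
  by rewrite mul1r; case: (_ == _).
have a2 : 0 < alpha ^+ 2.
  by rewrite exprn_even_gt0//=; apply: contraTneq ab => ->; rewrite mul0r ltxx.
set f := iter n H _ in t0 tp *.
(* After multiplication by [tau * alpha] the coefficients are [alpha^2] and [alpha * beta], both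
   positive. *)
have E y : tau * alpha * complex.Re (H f y) =
    alpha ^+ 2 * (tau * complex.Re (f (act_ai y))) + alpha ^+ 2 * (tau * complex.Re (f (act_a y)))
    + alpha * beta * (tau * complex.Re (f (act_bi y)) + tau * complex.Re (f (act_b y))).
  by rewrite ReH; ring.
exists (tau * alpha); split=> [y|]; rewrite iterS -/f E.
  by rewrite !addr_ge0// mulr_ge0// ?addr_ge0// ltW.
(* At [a^-(n+1) x] the summand coming from [a] evaluates [f] at [a^-n x], where it is strictly
   positive. *)
rewrite iterS act_aiK; apply: ltr_wpDr.
  by rewrite mulr_ge0 ?addr_ge0// ltW.
by apply: ltr_wpDl; [rewrite mulr_ge0// ltW|rewrite mulr_gt0].
Qed.

(** From index [N] on, [b^-1] agrees with [a^-1], so the four neighbours of a point merge in pairs.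
    The centre has index [N + k + 1] so that the step back by [b] also stays in this range. *)
Lemma ray_exists : 0 < val x < 1 -> exists N, forall (f : L) k,
  H f (iter (N + k).+1 (@act_ai R x) (base_point x)) = (alpha + beta)%:C *
    (f (iter (N + k).+2 (@act_ai R x) (base_point x)) +
     f (iter (N + k) (@act_ai R x) (base_point x))).
Proof.
move=> x01; have [N HN] := act_ai_eq_act_bi x01; exists N => f k.
pose p n := iter n (@act_ai R x) (base_point x).
have bi n : (N <= n)%N -> act_bi (p n) = p n.+1 by exact: HN.
have b n : (N <= n)%N -> act_b (p n.+1) = p n by move=> /bi <-; rewrite act_biK.
rewrite [H f _](_ : _ = H_fun alpha beta f (p (N + k).+1))// /H_fun.
rewrite bi ?leqW ?leq_addr// b ?leq_addr// [act_ai (p _)](_ : _ = p (N + k).+2)//.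
rewrite [act_a (p _)](_ : _ = p (N + k)%N); last by rewrite /p iterS act_aiK.
by rewrite -mulrDl rmorphD.
Qed.

End ThompsonOperator.

(** * The spectrum of [H] and the support of its spectral measure at [x] *)

Unset Implicit Arguments.

Theorem theorem2 (R : realType) (alpha beta : R) (x : I01 R) :
  alpha != 0 -> beta != 0 -> Num.sg alpha = Num.sg beta ->
  0 < val x < 1 ->
  let M : R := 2 * `|alpha + beta| in
  spectrum (H_op alpha beta x) = [set t%:C | t in [set` `[- M, M]]] /\
  (forall E, is_spectral_measure (H_op alpha beta x) E ->
    supp (diag_measure E (delta (base_point x))) = [set` `[- M, M]]).
Proof.
move=> a0 b0 sab x01 M.
have ab : 0 < alpha * beta.
  by rewrite -sgr_gt0 sgrM sab -expr2 exprn_even_gt0//= sgr_eq0.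
(* The equal signs make the norm bound of [H] coincide with the bound [2 |alpha + beta|] coming from
   the ray. *)
have nab : `|alpha + beta| = `|alpha| + `|beta|.
  have [ap|ap] := ltP 0 alpha.
    have bp : 0 < beta by rewrite -(pmulr_rgt0 _ ap).
    by rewrite !gtr0_norm// addr_gt0.
  have an : alpha < 0 by rewrite lt_neqAle a0.
  have bn : beta < 0 by rewrite -(nmulr_rgt0 _ an).
  by rewrite !ltr0_norm ?opprD//; lra.
have M0 : 0 <= M by rewrite /M mulr_ge0.
have HM f : ell2_norm (H_op alpha beta x f) <= M * ell2_norm f.
  by rewrite /M nab; exact: H_bound.
have [N HN] := ray_exists alpha beta x01.
(* Starting at [N.+1] keeps the base point, which has index 0, off the ray, so that its delta
   function vanishes there. *)
pose v k := iter (N.+1 + k) (@act_ai R x) (base_point x).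
have v_inj : injective v by move=> i j /(iter_act_ai_inj x01)/addnI.
have g0 : alpha + beta != 0.
  by rewrite -normr_gt0 nab addr_gt0 ?normr_gt0.
have Tv (f : ell2 R (Defs.orbit x)) k :
    H_op alpha beta x f (v k.+1) = (alpha + beta)%:C * (f (v k.+2) + f (v k)).
  by have := HN f k.+1; rewrite /v !addSn !addnS.
split.
  apply/seteqP; split; first exact: (spectrum_subset (@H_sym _ _ _ _) M0 HM).
  move=> _ [t /= tM <-]; apply: (ray_spectrum g0 v_inj Tv).
  by rewrite ler_norml; move: tM; rewrite in_itv.
move=> E HE; set d := delta (base_point x).
have Hsym := @H_sym R alpha beta x.
have muE B : diag_measure E d B = (dot (E B d) d)%:E by [].
apply/seteqP; split=> t.
  move=> tsupp; rewrite /= in_itv/= -ler_norml leNgt; apply/negP => Mt.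
  (* Half the distance from [t] to [[- M, M]]. On [U] the spectral parameter is beyond [M + e] in
     absolute value, with the sign of [t], so for [f = E U d] the quadratic form of [H] has size at
     least [(M + e) |f|^2]. The norm bound then forces [f = 0]. *)
  pose e := (`|t| - M) / 2; have e0 : 0 < e by rewrite divr_gt0// subr_gt0.
  pose U : set R := [set` `]t - e, t + e[].
  have mU : measurable U by exact: measurable_itv.
  have oU : open U by exact: interval_open.
  have Ut : U t by rewrite /U /= in_itv/=; lra.
  have := tsupp U oU Ut.
  rewrite muE (pvm_dot_self HE)// lte_fin.
  set f := E U d.
  have fU : E U f = f by rewrite /f (pvm_idem HE).
  have TfM : `|dot (H_op alpha beta x f) f| <= M * dot f f.
    rewrite ler_norml -sqr_ell2_norm expr2 mulrA; apply/andP; split.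
      rewrite lerNl -dotNl; apply: le_trans (dot_le_norm _ _) _.
      by rewrite ell2_normN ler_wpM2r ?ell2_norm_ge0.
    by apply: le_trans (dot_le_norm _ _) _; rewrite ler_wpM2r ?ell2_norm_ge0.
  have e2 : e + e = `|t| - M by rewrite /e; field.
  rewrite ltNge; apply/negP; rewrite negbK.
  have : e * dot f f <= 0; last by rewrite pmulr_rle0.
  move: TfM; rewrite ler_norml => /andP[TfM1 TfM2].
  case: (ltP 0 t) => t0.
    have Uc : U `<=` [set r | t - e <= r].
      by move=> r; rewrite /U /= in_itv/= => /andP[/ltW].
    have := spectral_ge HE mU Uc fU.
    by rewrite gtr0_norm// in e2; have -> : t - e = M + e by [lra]; lra.
  have Uc : U `<=` [set r | r <= t + e].
    by move=> r; rewrite /U /= in_itv/= => /andP[_ /ltW].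
  have := spectral_le HE mU Uc fU.
  rewrite ler0_norm// in e2; have -> : t + e = - (M + e) by lra.
  lra.
move=> tM U oU Ut.
have tM' : `|t| <= 2 * `|alpha + beta| by rewrite ler_norml; move: tM; rewrite /= in_itv.
rewrite ltNge; apply/negP; rewrite muE.
have mU : measurable U by exact: open_measurable.
rewrite (pvm_dot_self HE)// lee_fin => dle.
have EU : E U d = 0 by apply: dot_eq0; apply/le_anti; rewrite dle dot_ge0.
have [e /= e0 eU] : exists2 e : R, 0 < e & [set` `]t - e, t + e[] `<=` U.
  have /nbhs_ballP[e e0 eU] : nbhs t U by exact: open_nbhs_nbhs.
  exists e => // r; rewrite /= in_itv/= => /andP[r1 r2]; apply: eU.
  by rewrite /ball /= ltr_distlC; apply/andP; split; lra.
set V := [set` _] in eU.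
have mV : measurable V by exact: measurable_itv.
have EV : E V d = 0 by rewrite -(pvm_sub HE _ mV mU eU) EU linear0.
pose Z : set (ell2 R (Defs.orbit x)) := [set f | E V f = 0 /\ forall k, f (v k) = 0].
have cZ : closed_subspace Z.
  have [k0 klin kcl] := pvm_ker_closed HE mV.
  split=> [|f g c [f0 fv] [h0 gv]|f Hf]; first by split.
    split=> [|k]; first exact: klin.
    by have [_ h _] := eval_closed R (v k); apply: h.
  split=> [|k]; first by apply: kcl => e1 /Hf[g [g1 _] fg]; exists g.
  by have [_ _ h] := eval_closed R (v k); apply: h => e1 /Hf[g [_ g1] fg]; exists g.
have Zd : Z d.
  split=> // k; rewrite /d /=.
  by have /eqP/negPf -> : v k <> base_point x by move/(iter_act_ai_inj x01 (x2 := 0)).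
have Zinv f : Z f -> Z (H_op alpha beta x f).
  apply: (spectral_gap_invariant (s := t) Hsym M0 HM HE e0 cZ) => [g []//|g gV [_ gv]].
  split=> // k.
  by apply: (ray_vanish g0 v_inj Tv tM' (j := 0)) => // i _; exact: gv.
have Zn n : Z (iter n (H_op alpha beta x) d) by elim: n => //= n; exact: Zinv.
(* With [n = N.+1] the point [a^-n x] is [v 0], where positivity contradicts the vanishing on the
   ray. *)
have [tau [_]] := iter_H_pos x N.+1 ab.
have [_ /(_ 0)] := Zn N.+1.
by rewrite /v addn0 => ->; rewrite mulr0 ltxx.
Qed.
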